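(* Let $\lambda,c,L>0$, let $\Gamma=\{(x,y)\in\mathbb{R}^2:\ 0\le y\le L\}$, let $(X(t),Y(t))$ be the planar random motion with orthogonal directions $d_0,d_1,d_2,d_3$, velocity $c$ and switching rate $\lambda$, and let $\tau=\inf\{t>0:\ (X(t),Y(t))\notin\Gamma\}$. For $j=0,1,2,3$ let $u_j(x,y;z)$ be the (generalized) density in $z\in\mathbb{R}$ of the exit point on the lower boundary, $$u_j(x,y;z)\,\mathrm{d}z=\mathbb{P}\big(X(\tau)\in\mathrm{d}z,\ Y(\tau)=0\,\big|\,X(0)=x,\ Y(0)=y,\ D(0)=d_j\big),$$ and let $$\widetilde u_j(\alpha,y;z)=\int_{-\infty}^{\infty}e^{i\alpha x}\,u_j(x,y;z)\,\mathrm{d}x .$$ Then for all $0<y<L$, $z\in\mathbb{R}$ and $\alpha\in\mathbb{R}\setminus\{0\}$, $$\widetilde u_1(\alpha,y;z)=\frac{2\lambda^2\sinh\left(\frac{|\alpha|\lambda(L-y)}{\sqrt{\lambda^2+\alpha^2c^2}}\right)e^{i\alpha z}}{\big(\sqrt{\lambda^2+\alpha^2c^2}+|\alpha|c\big)^2e^{\frac{|\alpha|\lambda L}{\sqrt{\lambda^2+\alpha^2c^2}}}-\big(\sqrt{\lambda^2+\alpha^2c^2}-|\alpha|c\big)^2e^{-\frac{|\alpha|\lambda L}{\sqrt{\lambda^2+\alpha^2c^2}}}},$$ $$\widetilde u_3(\alpha,y;z)=e^{i\alpha z}\,\frac{\big(\sqrt{\lambda^2+\alpha^2c^2}+|\alpha|c\big)^2e^{\frac{|\alpha|\lambda(L-y)}{\sqrt{\lambda^2+\alpha^2c^2}}}-\big(\sqrt{\lambda^2+\alpha^2c^2}-|\alpha|c\big)^2e^{-\frac{|\alpha|\lambda(L-y)}{\sqrt{\lambda^2+\alpha^2c^2}}}}{\big(\sqrt{\lambda^2+\alpha^2c^2}+|\alpha|c\big)^2e^{\frac{|\alpha|\lambda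 L}{\sqrt{\lambda^2+\alpha^2c^2}}}-\big(\sqrt{\lambda^2+\alpha^2c^2}-|\alpha|c\big)^2e^{-\frac{|\alpha|\lambda L}{\sqrt{\lambda^2+\alpha^2c^2}}}},$$ and $$\widetilde u_0(\alpha,y;z)=\frac{\lambda}{2(\lambda+ic\alpha)}\big[\widetilde u_1(\alpha,y;z)+\widetilde u_3(\alpha,y;z)\big],\qquad \widetilde u_2(\alpha,y;z)=\frac{\lambda}{2(\lambda-ic\alpha)}\big[\widetilde u_1(\alpha,y;z)+\widetilde u_3(\alpha,y;z)\big].$$
   Context: Planar motion with orthogonal directions: the admissible directions are $d_j=(\cos(\pi j/2),\sin(\pi j/2))$, $j=0,1,2,3$ (indices modulo 4). At time $0$ the particle is at $(x,y)$ and picks one of the four directions with probability $\frac14$ each. It moves with constant speed $c>0$; at each event of a homogeneous Poisson process with intensity $\lambda>0$, independent of the initial direction, it turns from the current direction $d_j$ to $d_{j-1}$ or to $d_{j+1}$, each with probability $\frac12$, independently of everything else. $D(t)$ is the direction at time $t$. Meaning of the Fourier transform: the density $u_3$ has a Dirac component at $z=x$ (the particle started downwards may reach the lower boundary without turning), so the densities are generalized densities of finite measures. Since the strip is invariant under horizontal translations, $u_j(x,y;z)$ depends on $x,z$ only through $z-x$, and $\widetilde u_j$ is understood as $$\widetilde u_j(\alpha,y;z)=e^{i\alpha z}\,\mathbb{E}\Big[e^{-i\alpha (X(\tau)-x)}\,\mathbf{1}\{Y(\tau)=0\}\,\Big|\,X(0)=x,\ Y(0)=y,\ D(0)=d_j\Big],$$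 which does not depend on $x$. *)

(* Defs.v *)
From HB Require Import structures.
From mathcomp Require Import all_boot all_order all_algebra finmap.
From mathcomp Require Import all_classical all_reals all_analysis.
From mathcomp Require Import complex.

Set Implicit Arguments.
Unset Strict Implicit.
Unset Printing Implicit Defensive.
Import Order.TTheory GRing.Theory Num.Theory.
Import numFieldNormedType.Exports.

Local Open Scope classical_set_scope.
Local Open Scope ring_scope.
Local Open Scope complex_scope.

HB.instance Definition _ (n : nat) := isPointed.Build 'I_n.+1 ord0.

HB.instance Definition _ (n : nat) := @isMeasurable.Build default_measure_display
  'I_n.+1 discrete_measurable discrete_measurable0
  discrete_measurableC discrete_measurableU.

Section Independence.
Context {d : measure_display} {T : measurableType d} {R : realType}.
Variable P : probability T R.

Definition mutually_independent (I : choiceType) (F : I -> set (set T)) : Prop :=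
  forall (J : {fset I}) (E : I -> set T),
    (forall i, i \in J -> F i (E i)) ->
    P (\bigcap_(i in [set` J]) E i) = (\prod_(i <- J) P (E i))%E.

Definition sigma_of {d' : measure_display} {T' : measurableType d'}
    (X : T -> T') : set (set T) :=
  preimage_set_system [set: T] X measurable.

End Independence.

(* The directions d_j are indexed by 'Z_4, so that index arithmetic is modulo
   4. The Poisson process is given by its i.i.d. exponential interarrival times
   [wait]; the turn at its (k+1)-st event is from d_j to d_(j+1) if [turn k] is
   true and to d_(j-1) otherwise. In the index type of [noise_indep], [None]
   stands for [init], [Some (inl k)] for [wait k] and [Some (inr k)] for
   [turn k]. *)
Record motion_noise {d : measure_display} {T : measurableType d} {R : realType}
    (P : probability T R) (lambda : R) := MotionNoise {
  init : {RV P >-> 'Z_4} ;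
  wait : nat -> {RV P >-> R} ;
  turn : nat -> {RV P >-> bool} ;
  init_uniform : forall j : 'Z_4, P (init @^-1` [set j]) = (4^-1)%:E ;
  wait_exponential : forall (k : nat) (A : set R), measurable A ->
    P (wait k @^-1` A) = exponential_prob lambda A ;
  turn_fair : forall (k : nat) (b : bool), P (turn k @^-1` [set b]) = (2^-1)%:E ;
  noise_indep : mutually_independent P (fun i : option (nat + nat) =>
    match i with
    | None => sigma_of init
    | Some (inl k) => sigma_of (wait k)
    | Some (inr k) => sigma_of (turn k)
    end) }.

Section Motion.
Context {d : measure_display} {T : measurableType d} {R : realType}.
Context {P : probability T R} {lambda : R}.
Variables (M : motion_noise P lambda) (c L : R).

Definition direction (j : 'Z_4) : R * R :=
  (cos (pi * (j : nat)%:R / 2), sin (pi * (j : nat)%:R / 2)).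

Definition arrival (k : nat) (w : T) : R := \sum_(i < k) wait M i w.

(* The cardinal of an infinite set is 0 here; almost surely, only finitely many
   events occur up to time t. *)
Definition event_count (t : R) (w : T) : nat :=
  #|` fset_set [set k : nat | arrival k.+1 w <= t]|%fset.

Definition direction_at (t : R) (w : T) : 'Z_4 :=
  init M w + \sum_(k < event_count t w) (if turn M k w then 1 else - 1).

Definition position (x y t : R) (w : T) : R * R :=
  (x + c * \int[lebesgue_measure]_(s in `[0, t]) (direction (direction_at s w)).1,
   y + c * \int[lebesgue_measure]_(s in `[0, t]) (direction (direction_at s w)).2).

Definition strip : set (R * R) := [set p | 0 <= p.2 <= L].

Definition exit_time (x y : R) (w : T) : \bar R :=
  ereal_inf (EFin @` [set t | 0 < t /\ ~ strip (position x y t w)]).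

(* Only used on the event that the exit time is finite. *)
Definition exit_point (x y : R) (w : T) : R * R :=
  position x y (fine (exit_time x y w)) w.

Definition lower_exit (x y : R) : set T :=
  [set w | exit_time x y w \is a fin_num /\ (exit_point x y w).2 = 0].

Definition cis (t : R) : R[i] := cos t +i* sin t.

Definition cond_expectation (f : T -> R[i]) (A : set T) : R[i] :=
  (fine ('E_P[fun w => complex.Re (f w) * \1_A w]) / fine (P A))
  +i* (fine ('E_P[fun w => complex.Im (f w) * \1_A w]) / fine (P A)).

(* Fourier transform in the starting abscissa of the law of the exit point on
   the lower boundary, started from (x, y) with direction d_j. That law need
   not have a density, but by horizontal translation invariance it depends on
   x and z through z - x only, so that the transform is
   e^(i alpha z) E[e^(- i alpha (X(tau) - x)) 1{Y(tau) = 0} | D(0) = d_j],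
   for any x. *)
Definition u_tilde (x : R) (j : 'Z_4) (alpha y z : R) : R[i] :=
  cis (alpha * z) *
  cond_expectation
    (fun w => cis (- (alpha * ((exit_point x y w).1 - x)))
              * (\1_(lower_exit x y) w)%:C)
    [set w | direction_at 0 w = j].

End Motion.

Definition sinh {R : realType} (t : R) : R := (expR t - expR (- t)) / 2.

(* Main.v *)
From HB Require Import structures.
Require Import Defs.
From mathcomp Require Import all_boot all_order all_algebra finmap.
From mathcomp Require Import all_classical all_reals all_analysis measurable_realfun.
From mathcomp Require Import complex ring lra.

(** Between two events of the Poisson process the particle moves along a
    segment. Its path is therefore a polygonal line, and the corners of this
    line form a Markov chain: from a corner, travel in the current direction
    for an exponential time, then turn left or right with probability 1/2 each.
    A vertical segment does not change the abscissa and a horizontal one does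
    not change the ordinate. Hence the particle leaves the strip inside a
    vertical segment, with the abscissa of the corner at its end, and the exit
    problem only concerns the chain of corners, stopped at the first corner
    outside the strip ([chain], [exit_chain]).

    Write th = alpha (X - x) + beta; the choices beta = 0 and beta = pi / 2 give
    the real and the imaginary part of exp (- i alpha (X - x)). Put
    m = (g1 + g3) / 2 and kap = lambda^2 / (lambda^2 + alpha^2 c^2), where g1 and
    g3 solve the boundary value problem
      c g1' = lambda (g1 - kap m),  c g3' = lambda (kap m - g3),
      g1 L = 0,  g3 0 = 1.
    The function [value], which is cos th g1 or cos th g3 on upward or downward
    legs, the matching combination of cos th and sin th times m on horizontal
    legs, cos th below the strip and 0 above it, is harmonic for the chain
    ([integral_turn_average]). On a horizontal leg this is the Laplace transform
    of the cosine, the source of the factors lambda / (lambda +- i c alpha);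
    averaging over the two horizontal directions leaves kap. On a vertical leg
    it is the differential equation integrated against the exponential density
    up to the time when the boundary is reached.

    The expectation of [value] along the chain is thus constant. Almost surely
    some vertical leg is longer than the height of the strip, so that the chain
    is eventually outside, and [value] along it eventually equals the cosine of
    the phase at the exit point on a lower exit and 0 on an upper one
    ([value_exit]). By dominated convergence the expectation of this limit is
    the value at the starting point ([expectation_eventually_value]), and the
    real and imaginary parts combine into the Fourier transform
    ([u_tilde_value]). It remains to solve the boundary value problem, whose
    solutions are combinations of exp (+- |alpha| lambda (L - y) / s) with
    s = sqrt (lambda^2 + alpha^2 c^2).

    Three points need care. The Markov property has to be extracted from the
    product rule for finite families of events; this is an induction through
    the uniqueness of product measures ([chain_independent]). The description
    by corners fails on a null set, where waits vanish or a turn happens exactly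
    on the boundary ([ae_wait_gt0], [ae_long_wait], [ae_chain_off_boundary]).
    Finally, the exit point is only known to agree almost surely with a
    measurable function, so that integrals of arbitrary functions have to be
    compared off a null set ([integral_null_restrict]). *)

Set Implicit Arguments.
Unset Strict Implicit.
Unset Printing Implicit Defensive.
Import Order.TTheory GRing.Theory Num.Theory.
Import numFieldNormedType.Exports.
Local Open Scope classical_set_scope.
Local Open Scope ring_scope.

(** * Integration against a density and the exponential law *)
Section Density.
Context d {X : measurableType d} {R : realType}.
Variables (mu nu : {measure set X -> \bar R}) (p : X -> R).
Hypothesis p_ge0 : forall x, 0 <= p x.
Hypothesis mp : measurable_fun setT p.
Hypothesis nuE : forall A, measurable A -> nu A = (\int[mu]_(x in A) (p x)%:E)%E.

Import HBNNSimple.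

Let integral_density_nnsfun (h : {nnsfun X >-> R}) :
  (\int[nu]_x (h x)%:E = \int[mu]_x ((h x)%:E * (p x)%:E))%E.
Proof.
have mEp : measurable_fun setT (EFin \o p) by exact/measurable_EFinP.
under [LHS]eq_integral do rewrite fimfunE -fsumEFin//.
rewrite [LHS]ge0_integral_fsum//; last 2 first.
  - by move=> r; exact/measurable_EFinP/measurableT_comp.
  - by move=> n x _; rewrite EFinM nnfun_muleindic_ge0.
under [RHS]eq_integral.
  move=> x xD; rewrite fimfunE -fsumEFin//.
  rewrite muleC ge0_mule_fsumr; last first.
    by move=> r; rewrite EFinM nnfun_muleindic_ge0.
  over.
rewrite [RHS]ge0_integral_fsum//; last 2 first.
  - move=> r; apply: emeasurable_funM => //.
    by apply/measurable_EFinP; do 2 apply/measurableT_comp => //.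
  - by move=> n x _; rewrite EFinM mule_ge0 ?nnfun_muleindic_ge0// lee_fin.
apply: eq_fsbigr => r _.
rewrite (integralZl_indic measurableT (fun k => h @^-1` [set k]))//; last first.
  by move=> r0; exact: preimage_nnfun0.
rewrite integral_indic// setIT nuE//.
have [r0|r0] := leP 0 r; last first.
  rewrite preimage_nnfun0// integral_set0 mule0 integral0_eq// => x _.
  by rewrite indic0 mulr0 mule0.
rewrite -ge0_integralZl//=; [|exact: measurable_funTS|by move=> *; rewrite lee_fin].
rewrite [in LHS]integral_mkcond; apply: eq_integral => x _.
rewrite patchE indicE; case: ifPn => /= _.
  by rewrite mulr1 muleC.
by rewrite mulr0 mule0.
Qed.

(** The hypothesis is the case of indicators; linearity gives simple functions
    and monotone convergence the rest. *)
Lemma ge0_integral_density (f : X -> \bar R) : measurable_fun setT f ->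
  (forall x, 0 <= f x)%E ->
  (\int[nu]_x f x = \int[mu]_x (f x * (p x)%:E))%E.
Proof.
move=> mf f0; pose f_ := nnsfun_approx measurableT mf.
have mEp : measurable_fun setT (EFin \o p) by exact/measurable_EFinP.
transitivity (limn (fun n => (\int[nu]_x (f_ n x)%:E)%E)).
  rewrite -monotone_convergence//=.
  - apply: eq_integral => x _; apply/esym/cvg_lim => //=.
    exact: cvg_nnsfun_approx.
  - by move=> n; exact/measurable_EFinP.
  - by move=> n x _; rewrite lee_fin.
  - by move=> x _ a b ab; rewrite lee_fin//; exact/lefP/nd_nnsfun_approx.
rewrite (_ : (\int[mu]_x _)%E =
    limn (fun n => (\int[mu]_x ((f_ n x)%:E * (p x)%:E))%E)); last first.
  rewrite -monotone_convergence//=.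
  - apply: eq_integral => x _; apply/esym/cvg_lim => //.
    apply: cvgeZr => //.
    exact: (@cvg_nnsfun_approx _ _ _ _ measurableT _ mf).
  - by move=> n; apply: emeasurable_funM => //; exact/measurable_EFinP.
  - by move=> n x _; rewrite mule_ge0 ?lee_fin.
  - move=> x _ a b ab; rewrite lee_wpmul2r ?lee_fin//.
    exact/lefP/nd_nnsfun_approx.
by congr (limn _); apply/funext => n; rewrite integral_density_nnsfun.
Qed.

End Density.

(** The exponential law enters below through an arbitrary measure [nu] with
    its values, on the copy of the reals that carries Lebesgue measure. *)
Section ExponentialLaw.
Context {R : realType}.
Implicit Types (f F : R -> R) (a b l : R).
Local Notation leb := (@lebesgue_measure R).

Lemma integral_itvcc_is_derive f F a b : a <= b -> continuous f ->
  (forall x : R, is_derive x 1 F (f x)) ->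
  (\int[leb]_(x in `[a, b]) (f x)%:E = (F b - F a)%:E)%E.
Proof.
move=> ab cf dF; have cF : continuous F.
  move=> x; apply: differentiable_continuous; apply/derivable1_diffP.
  by have [] := dF x.
move: ab; rewrite le_eqVlt => /predU1P[->|ab].
  by rewrite set_itv1 integral_set1 subrr.
rewrite (@continuous_FTC2 _ f F)//.
- exact: continuous_subspaceT.
- split.
  + by move=> x _; have [] := dF x.
  + by apply: cvg_at_right_filter; apply: cF.
  + by apply: cvg_at_left_filter; apply: cF.
- by move=> x _; rewrite derive1E; have [] := dF x.
Qed.

Lemma integral_itvcy_is_derive f F a l : (forall x, a <= x -> 0 <= f x) ->
  continuous f -> (forall x : R, is_derive x 1 F (f x)) -> F x @[x --> +oo] --> l ->
  (\int[leb]_(x in `[a, +oo[) (f x)%:E = (l - F a)%:E)%E.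
Proof.
move=> f0 cf dF Fl; have cF : continuous F.
  move=> x; apply: differentiable_continuous; apply/derivable1_diffP.
  by have [] := dF x.
rewrite (@ge0_continuous_FTC2y _ f F a l)//.
- exact: continuous_subspaceT.
- by apply: cvg_at_right_filter; apply: cF.
- by move=> x _; rewrite derive1E; have [] := dF x.
Qed.

Variable lambda : R.
Hypothesis lambda_gt0 : 0 < lambda.
Variable nu : {measure set (measurableTypeR R) -> \bar R}.
Hypothesis nuE : forall A, measurable A -> nu A = exponential_prob lambda A.

Lemma ge0_integral_exponential (f : measurableTypeR R -> \bar R) :
  measurable_fun setT f ->
  (forall x, 0 <= f x)%E ->
  (\int[nu]_x f x =
   \int[leb]_(x in `[0%R, +oo[) (f x * (lambda * expR (- (lambda * x)))%:E))%E.
Proof.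
move=> mf f0; rewrite (@ge0_integral_density _ _ R leb nu (exponential_pdf lambda))//.
- rewrite [RHS]integral_mkcond; apply: eq_integral => x _.
  rewrite /exponential_pdf !patchE; case: ifPn => _; last by rewrite mule0.
  by rewrite mulNr.
- by move=> x; rewrite exponential_pdf_ge0// ltW.
- exact: measurable_exponential_pdf.
Qed.

Lemma exponential_null1 a : nu [set a] = 0%E.
Proof. by rewrite nuE// /exponential_prob integral_set1. Qed.

Lemma exponential_le0 : nu `]-oo, 0]%classic = 0%E.
Proof.
rewrite nuE// /exponential_prob -integral_itv_bndo_bndc; last first.
  apply: measurable_funTS; apply/measurable_EFinP.
  exact: measurable_exponential_pdf.
apply: integral0_eq => x /=; rewrite in_itv/= => x0.
by rewrite lt0_exponential_pdf.
Qed.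

Lemma exponential_le a : 0 < a -> nu `]-oo, a]%classic = (1 - expR (- (lambda * a)))%:E.
Proof.
move=> a0; have -> : `]-oo, a]%classic = `]-oo, 0]%classic `|` `]0, a]%classic.
  by rewrite -itv_bndbnd_setU// bnd_simp ltW.
rewrite measureU//=; last first.
  rewrite -subset0 => x [] /=; rewrite !in_itv/= => x0 /andP[].
  by rewrite ltNge x0.
rewrite [X in (X + _)%E]exponential_le0 add0e nuE// /exponential_prob.
rewrite integral_itv_obnd_cbnd; last first.
  apply: measurable_funTS; apply/measurable_EFinP.
  exact: measurable_exponential_pdf.
by rewrite [LHS]exponential_prob_itv0c// mulNr.
Qed.

End ExponentialLaw.

(** * Damped oscillations *)
Section DampedOscillation.
Context {R : realType}.
Implicit Types (a b k x y : R).

Lemma is_derive_add (f g : R -> R) df dg (x : R) :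
  is_derive x 1 f df -> is_derive x 1 g dg ->
  is_derive x 1 (fun w : R => f w + g w) (df + dg).
Proof. by move=> hf hg; exact: is_deriveD. Qed.

Lemma is_derive_mul (f g : R -> R) df dg (x : R) :
  is_derive x 1 f df -> is_derive x 1 g dg ->
  is_derive x 1 (fun w : R => f w * g w) (df * g x + f x * dg).
Proof.
move=> hf hg; have := is_deriveM hf hg.
by rewrite /GRing.scale /= addrC (mulrC df).
Qed.

Lemma is_derive_mull k (f : R -> R) df (x : R) :
  is_derive x 1 f df -> is_derive x 1 (fun w : R => k * f w) (k * df).
Proof. by move=> hf; exact: is_deriveZ. Qed.

Lemma is_derive_affine a b (x : R) : is_derive x 1 (fun w : R => a + b * w) b.
Proof.
have h := is_derive_add (is_derive_cst a x 1) (is_derive_mull b (is_derive_id x 1)).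
by rewrite add0r mulr1 in h.
Qed.

Lemma is_derive_comp_affine (f : R -> R) df a b (x : R) :
  is_derive (a + b * x) 1 f df ->
  is_derive x 1 (fun w : R => f (a + b * w)) (b * df).
Proof.
move=> hf; have := is_derive_affine a b x => h.
by have := @is_derive1_comp _ f (fun w : R => a + b * w) x df b hf h; rewrite mulrC.
Qed.

Lemma is_derive_expRM k (x : R) :
  is_derive x 1 (fun w : R => expR (- (k * w))) (- k * expR (- (k * x))).
Proof.
have -> : (fun w : R => expR (- (k * w))) = (fun w : R => expR (0 + - k * w)).
  by apply/funext => w; rewrite add0r mulNr.
have -> : - (k * x) = 0 + - k * x by rewrite add0r mulNr.
exact: is_derive_comp_affine.
Qed.

Lemma cvgy_expRM k : 0 < k -> expR (- (k * x)) @[x --> +oo] --> (0 : R).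
Proof.
move=> k0; apply: (@cvg_comp _ _ _ (fun x => k * x) (fun z => expR (- z)) _ (pinfty_nbhs R));
  last exact: cvgr_expR.
exact: gt0_cvgMry.
Qed.

Lemma cvgy_bounded_expRM (f : R -> R) k C : 0 < k -> (forall x, `|f x| <= C) ->
  expR (- (k * x)) * f x @[x --> +oo] --> (0 : R).
Proof.
move=> k0 fC; apply/norm_cvg0P; apply: (@squeeze_cvgr _ _ _ _ (cst 0) (fun x => C * expR (- (k * x)))).
- apply: nearW => x; rewrite /= normr_ge0 normrM ger0_norm ?expR_ge0// mulrC.
  by rewrite ler_wpM2r ?expR_ge0.
- exact: cvg_cst.
- rewrite -[0](mulr0 C); apply: cvgM; [exact: cvg_cst|exact: cvgy_expRM].
Qed.

Lemma is_derive_continuous (f df : R -> R) :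
  (forall x : R, is_derive x 1 f (df x)) -> continuous f.
Proof.
move=> dF x; apply: differentiable_continuous; apply/derivable1_diffP.
by have [] := dF x.
Qed.

(** A primitive of lam exp (- lam w) (K + m cos (th + om w)). The constant K
    is there to make this integrand nonnegative, so that its improper integral
    is the difference of the limits of the primitive. *)
Definition damped_wave_primitive (lam om th K m w : R) : R :=
  expR (- (lam * w)) *
  (- K + m * ((- lam ^+ 2) * cos (th + om * w) + lam * om * sin (th + om * w))
       / (lam ^+ 2 + om ^+ 2)).

Lemma is_derive_damped (lam om th K m x : R) : 0 < lam ->
  is_derive x 1 (damped_wave_primitive lam om th K m)
    ((K + cos (th + om * x) * m) * (lam * expR (- (lam * x)))).
Proof.
move=> lam0.
have dc := @is_derive_comp_affine cos _ th om x (is_derive_cos _).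
have ds := @is_derive_comp_affine sin _ th om x (is_derive_sin _).
have de := is_derive_expRM lam x.
have s0 : lam ^+ 2 + om ^+ 2 != 0.
  by rewrite gt_eqF// ltr_pwDl ?exprn_gt0// sqr_ge0.
have d3 := is_derive_mull (m / (lam ^+ 2 + om ^+ 2))
  (is_derive_add (is_derive_mull (- lam ^+ 2) dc) (is_derive_mull (lam * om) ds)).
have := is_derive_mul de (is_derive_add (is_derive_cst (- K) x 1) d3).
set F := (X in is_derive x 1 X _); set dF := (X in is_derive x 1 _ X) => h.
have -> : damped_wave_primitive lam om th K m = F.
  by apply/funext => w; rewrite /damped_wave_primitive /F /cst; congr (_ * (_ + _)); field.
apply: is_derive_eq; rewrite /dF /cst.
by field.
Qed.

Lemma cvgy_damped (lam om th K m : R) : 0 < lam ->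
  damped_wave_primitive lam om th K m x @[x --> +oo] --> (0 : R).
Proof.
move=> lam0; have s0 : 0 < lam ^+ 2 + om ^+ 2 by rewrite ltr_pwDl ?exprn_gt0// sqr_ge0.
apply: (@cvgy_bounded_expRM _ lam
  (`|K| + `|m| * (lam ^+ 2 + `|lam * om|) / (lam ^+ 2 + om ^+ 2))) => // x.
rewrite (le_trans (ler_normD _ _))// normrN lerD2l// !normrM.
rewrite (@ger0_norm _ (_^-1)) ?invr_ge0 ?(ltW s0)//.
rewrite ler_wpM2r ?invr_ge0 ?(ltW s0)// ler_wpM2l//.
rewrite (le_trans (ler_normD _ _))// lerD// normrM.
  by rewrite normrN normrX (@ger0_norm _ lam) ?(ltW lam0)// ler_piMr ?sqr_ge0// cos_max.
by rewrite ?normrM ler_piMr ?mulr_ge0 ?sin_max.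
Qed.

End DampedOscillation.

(** * The corner chain and its harmonic functions *)
Local Notation state R := ('Z_4 * (R * R))%type.

Section StoppedIntegral.
Context {R : realType}.
Variable lambda : R.
Hypothesis lambda_gt0 : 0 < lambda.
Local Notation leb := (@lebesgue_measure R).

(** A payment q is made at rate lambda until time l, and then the amount G l
    at the next event. The equation G' = lambda (G - q) says that
    - exp (- lambda w) G w is a primitive of lambda exp (- lambda w) q w, so
    that the boundary terms at l cancel and only G 0 is left. As before, K
    makes everything nonnegative. *)
Lemma integral_stopped (f q G : R -> R) (K l : R) : 0 <= l ->
  measurable_fun setT f -> (forall w, 0 <= f w) -> continuous q ->
  (forall w : R, is_derive w 1 G (lambda * (G w - q w))) ->
  (forall w, 0 <= w <= l -> f w = K + q w) -> (forall w, l < w -> f w = K + G l) ->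
  (\int[leb]_(w in `[0%R, +oo[) (f w * (lambda * expR (- (lambda * w))))%:E =
   (K + G 0)%:E)%E.
Proof.
move=> l0 mf f0 cq dG fq fG.
have cexp : continuous (fun w : R => lambda * expR (- (lambda * w))).
  move=> w; apply: cvgM; first exact: cvg_cst.
  exact: (is_derive_continuous (is_derive_expRM lambda)).
have mg : measurable_fun setT (fun w => (f w * (lambda * expR (- (lambda * w))))%:E).
  apply/measurable_EFinP; apply: measurable_funM => //.
  exact: continuous_measurable_fun.
have g0 w : 0 <= f w * (lambda * expR (- (lambda * w))).
  by rewrite mulr_ge0// mulr_ge0 ?expR_ge0// ltW.
have -> : `[0%R, +oo[%classic = `[0%R, l]%classic `|` `]l, +oo[%classic.
  by rewrite -itv_bndbnd_setU// bnd_simp.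
rewrite ge0_integral_setU//=; last 3 first.
- exact: measurable_funTS.
- by move=> x _; rewrite lee_fin.
- rewrite disj_set2E; apply/eqP; rewrite -subset0 => x [] /=; rewrite !in_itv/= andbT.
  by move=> /andP[_ xl] /(le_lt_trans xl); rewrite ltxx.
have K_l : 0 <= K + G l by rewrite -(fG (l + 1)) ?f0// ltrDl.
have -> : (\int[leb]_(w in `]l, +oo[) (f w * (lambda * expR (- (lambda * w))))%:E =
  ((K + G l) * expR (- (lambda * l)))%:E)%E.
  under eq_integral.
    move=> w; rewrite inE/= in_itv/= andbT => lw; rewrite (fG _ lw); over.
  rewrite integral_itv_obnd_cbnd; last first.
    apply: measurable_funTS; apply/measurable_EFinP; apply: measurable_funM => //.
    exact: continuous_measurable_fun.
  have dF (w : R) : is_derive w 1 (fun w => - (K + G l) * expR (- (lambda * w)))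
      ((K + G l) * (lambda * expR (- (lambda * w)))).
    have := is_derive_mull (- (K + G l)) (is_derive_expRM lambda w).
    by move=> h; apply: is_derive_eq; ring.
  rewrite (integral_itvcy_is_derive (l := 0) _ _ dF).
  - by rewrite sub0r mulNr opprK.
  - by move=> w _; rewrite mulr_ge0// mulr_ge0 ?expR_ge0// ltW.
  - by move=> w; apply: cvgM; [exact: cvg_cst|exact: cexp].
  - rewrite -[X in _ --> X](mulr0 (- (K + G l))); apply: cvgM; first exact: cvg_cst.
    exact: cvgy_expRM.
have -> : (\int[leb]_(w in `[0%R, l]) (f w * (lambda * expR (- (lambda * w))))%:E =
  ((K + G 0) - (K + G l) * expR (- (lambda * l)))%:E)%E.
  under eq_integral.
    move=> w; rewrite inE/= in_itv/= => lw; rewrite (fq _ lw); over.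
  have dF (w : R) : is_derive w 1 (fun w => expR (- (lambda * w)) * (- K + -1 * G w))
      ((K + q w) * (lambda * expR (- (lambda * w)))).
    have := is_derive_mul (is_derive_expRM lambda w)
      (is_derive_add (is_derive_cst (- K) w 1) (is_derive_mull (-1) (dG w))).
    by move=> h; apply: is_derive_eq; rewrite /cst; ring.
  rewrite (integral_itvcc_is_derive l0 _ dF).
  - by congr (_%:E); rewrite mulr0 oppr0 expR0; ring.
  - by move=> w; apply: cvgM; [apply: cvgD; [exact: cvg_cst|exact: cq]|exact: cexp].
by rewrite -EFinD; congr (_%:E); ring.
Qed.

End StoppedIntegral.

Lemma Z4_cases (d : 'Z_4) : [\/ d = 0, d = 1, d = 2 | d = 3].
Proof.
by case: d => -[|[|[|[|//]]]] i;
  [apply: Or41|apply: Or42|apply: Or43|apply: Or44]; apply/val_inj.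
Qed.

Lemma measurable_Z4 d (U : measurableType d) (f : 'Z_4 -> U) : measurable_fun setT f.
Proof. by []. Qed.

Section Directions.
Context {R : realType}.

(** The directions with the trigonometric functions evaluated, in a form that
    computes on each of the four indices. *)
Definition dirx (d : 'Z_4) : R := if d == 0 then 1 else if d == 2 then -1 else 0.
Definition diry (d : 'Z_4) : R := if d == 1 then 1 else if d == 3 then -1 else 0.

Lemma directionE d : direction d = (dirx d, diry d) :> R * R.
Proof.
have E : pi * 3 / 2 = pi / 2 + pi :> R by field.
case: (Z4_cases d) => ->; rewrite /direction /dirx /diry /=.
- by rewrite mulr0 mul0r cos0 sin0.
- by rewrite mulr1 cos_pihalf sin_pihalf.
- by rewrite mulfK ?pnatr_eq0// cospi sinpi.
- by rewrite E cosDpi sinDpi cos_pihalf sin_pihalf oppr0.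
Qed.

Lemma normr_dirx_le1 d : `|dirx d| <= 1.
Proof. by rewrite /dirx; case: ifP => _; [|case: ifP => _]; rewrite ?normrN ?normr1 ?normr0. Qed.

Lemma normr_diry_le1 d : `|diry d| <= 1.
Proof. by rewrite /diry; case: ifP => _; [|case: ifP => _]; rewrite ?normrN ?normr1 ?normr0. Qed.

End Directions.

Section Step.
Context {R : realType}.
Variables (c L : R).

Definition turned (b : bool) (d : 'Z_4) : 'Z_4 := d + (if b then 1 else -1).

Definition alive (s : state R) : bool := 0 <= s.2.2 <= L.

(** A state consists of the direction in which the particle leaves a corner
    and of the position of this corner. Outside the strip the chain stays
    where it is, which keeps the ordinate as a record of the side of the exit. *)
Definition step (b : bool) (s : state R) (w : R) : state R :=
  if alive s then
    (turned b s.1, (s.2.1 + c * w * dirx s.1, s.2.2 + c * w * diry s.1))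
  else s.

Lemma measurable_state_dir d (U : measurableType d) (f : 'Z_4 -> U) :
  measurable_fun setT (fun s : state R => f s.1).
Proof. exact: (measurableT_comp (@measurable_Z4 _ _ f) measurable_fst). Qed.

Lemma measurable_abscissa : measurable_fun setT (fun s : state R => s.2.1).
Proof. exact: (measurableT_comp measurable_fst measurable_snd). Qed.

Lemma measurable_ordinate : measurable_fun setT (fun s : state R => s.2.2).
Proof. exact: (measurableT_comp measurable_snd measurable_snd). Qed.

Lemma measurable_alive : measurable_fun setT alive.
Proof.
by apply: measurable_and; apply: measurable_fun_ler => //; exact: measurable_ordinate.
Qed.

Lemma measurable_step b :
  measurable_fun setT (fun p : state R * measurableTypeR R => step b p.1 p.2).
Proof.
have mw : measurable_fun setT
  (fun p : state R * measurableTypeR R => p.2 : R) by exact: measurable_snd.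
apply: measurable_fun_ifT; last exact: measurable_fst.
  exact: (measurableT_comp measurable_alive measurable_fst).
apply: measurable_fun_pair.
  exact: (measurableT_comp (measurable_state_dir (turned b)) measurable_fst).
apply: measurable_fun_pair; apply: measurable_funD.
- exact: (measurableT_comp measurable_abscissa measurable_fst).
- apply: measurable_funM; first exact: measurable_funM.
  exact: (measurableT_comp (measurable_state_dir dirx) measurable_fst).
- exact: (measurableT_comp measurable_ordinate measurable_fst).
- apply: measurable_funM; first exact: measurable_funM.
  exact: (measurableT_comp (measurable_state_dir diry) measurable_fst).
Qed.

End Step.

(** The boundary value problem for (g1, g3) is stated abstractly; an explicit
    solution is only needed at the very end. *)
Section Value.
Context {R : realType}.
Variables (lambda c L alpha beta x0 : R) (g1 g3 : R -> R).
Hypotheses (lambda_gt0 : 0 < lambda) (c_gt0 : 0 < c) (L_gt0 : 0 < L).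

Let om := alpha * c.
Let mean y := (g1 y + g3 y) / 2.
Let kap := lambda ^+ 2 / (lambda ^+ 2 + om ^+ 2).

Hypothesis dg1 : forall y : R, is_derive y 1 g1 (lambda * (g1 y - kap * mean y) / c).
Hypothesis dg3 : forall y : R, is_derive y 1 g3 (lambda * (kap * mean y - g3 y) / c).
Hypotheses (g1_L : g1 L = 0) (g3_0 : g3 0 = 1).

Definition phase (x : R) : R := alpha * (x - x0) + beta.

Definition value_at (d : 'Z_4) (th y : R) : R :=
  if d == 1 then cos th * g1 y
  else if d == 3 then cos th * g3 y
  else (lambda ^+ 2 * cos th - lambda * (om * dirx d) * sin th)
       / (lambda ^+ 2 + om ^+ 2) * mean y.

Definition value (s : state R) : R :=
  if s.2.2 < 0 then cos (phase s.2.1)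
  else if L < s.2.2 then 0
  else value_at s.1 (phase s.2.1) s.2.2.

Let cg1 : continuous g1. Proof. exact: is_derive_continuous dg1. Qed.
Let cg3 : continuous g3. Proof. exact: is_derive_continuous dg3. Qed.

Let cmean : continuous mean.
Proof.
by move=> y; apply: cvgM; [apply: cvgD; [exact: cg1|exact: cg3]|exact: cvg_cst].
Qed.

Let phase_add x h : phase (x + h) = phase x + alpha * h.
Proof. by rewrite /phase; ring. Qed.

Let den_gt0 : 0 < lambda ^+ 2 + om ^+ 2.
Proof. by rewrite ltr_pwDl ?exprn_gt0// sqr_ge0. Qed.

Lemma measurable_value : measurable_fun setT value.
Proof.
have mph : measurable_fun setT (fun s : state R => phase s.2.1).
  apply: measurable_funD => //; apply: measurable_funM => //.
  by apply: measurable_funB => //; exact: measurable_abscissa.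
have mcos : measurable_fun setT (fun s : state R => cos (phase s.2.1)).
  apply: measurableT_comp => //; exact: continuous_measurable_fun (@continuous_cos R).
have msin : measurable_fun setT (fun s : state R => sin (phase s.2.1)).
  apply: measurableT_comp => //; exact: continuous_measurable_fun (@continuous_sin R).
have my (f : R -> R) : continuous f ->
    measurable_fun setT (fun s : state R => f s.2.2).
  move=> cf; apply: measurableT_comp; last exact: measurable_ordinate.
  exact: continuous_measurable_fun.
apply: measurable_fun_ifT => //.
  by apply: measurable_fun_ltr => //; exact: measurable_ordinate.
apply: measurable_fun_ifT => //.
  by apply: measurable_fun_ltr => //; exact: measurable_ordinate.
apply: measurable_fun_ifT => //.
- exact: (measurable_state_dir (fun d => d == 1)).
- by apply: measurable_funM => //; exact: my.
apply: measurable_fun_ifT => //.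
- exact: (measurable_state_dir (fun d => d == 3)).
- by apply: measurable_funM => //; exact: my.
apply: measurable_funM; last exact: my.
apply: measurable_funM => //; apply: measurable_funB; apply: measurable_funM => //.
exact: (measurable_state_dir (fun d => lambda * (om * dirx d))).
Qed.

(** On the strip g1 and g3 are bounded by compactness, and the horizontal
    coefficients are bounded because cosine and sine are. *)
Lemma bounded_value : exists K, forall s, `|value s| <= K.
Proof.
have bnd (f : R -> R) : continuous f -> exists B, 0 <= B /\ forall y, 0 <= y <= L -> `|f y| <= B.
  move=> cf; have ca : {within `[0, L], continuous (fun y => `|f y|)}.
    apply: continuous_subspaceT => y; apply: cvg_norm; exact: cf.
  have [y0 y0in hB] := EVT_max (ltW L_gt0) ca.
  exists `|f y0|; split => // y yin; apply: hB; rewrite in_itv/=; exact: yin.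
have [B1 [B10 hB1]] := bnd _ cg1; have [B3 [B30 hB3]] := bnd _ cg3.
have [B2 [B20 hB2]] := bnd _ cmean.
pose Q := (lambda ^+ 2 + `|lambda * om|) / (lambda ^+ 2 + om ^+ 2).
have Q0 : 0 <= Q by rewrite divr_ge0 ?addr_ge0 ?sqr_ge0 ?(ltW den_gt0).
(* One summand for each branch of [value]. *)
exists (1 + B1 + B3 + Q * B2) => -[d [X Y]]; rewrite /value /=.
have cosB t : `|cos t : R| <= 1 by exact: cos_max.
have QB : 0 <= Q * B2 by rewrite mulr_ge0.
case: ifPn => [_|]; first by have := cosB (phase X); lra.
rewrite -leNgt => Y0; case: ifPn => [_|]; first by rewrite normr0; lra.
rewrite -leNgt => YL; have Yin : 0 <= Y <= L by rewrite Y0.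
rewrite /value_at; case: ifPn => [_|_].
  have : `|cos (phase X) * g1 Y| <= B1.
    by rewrite normrM (le_trans _ (hB1 _ Yin))// ler_piMl.
  by lra.
case: ifPn => [_|_].
  have : `|cos (phase X) * g3 Y| <= B3.
    by rewrite normrM (le_trans _ (hB3 _ Yin))// ler_piMl.
  by lra.
set v := (X in `|X * _|).
have : `|v * mean Y| <= Q * B2.
  rewrite normrM ler_pM ?hB2//.
  rewrite /v normrM (@ger0_norm _ (_^-1)) ?invr_ge0 ?(ltW den_gt0)//.
  rewrite ler_wpM2r ?invr_ge0 ?(ltW den_gt0)//.
  rewrite (le_trans (ler_normB _ _))// lerD//.
    by rewrite normrM normrX (@ger0_norm _ lambda) ?(ltW lambda_gt0)// ler_piMr ?sqr_ge0.
  rewrite normrM mulrA (le_trans (ler_piMr _ (sin_max _)))//.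
  by rewrite normrM ler_piMr ?normr_dirx_le1.
by lra.
Qed.

Variable K : R.
Hypothesis value_K : forall s, 0 <= K + value s.

(** The mean over the two turns after a leg of duration w. The shift by K, a
    bound for [value], allows nonnegative integrals throughout. *)
Definition turn_average (s : state R) (w : R) : R :=
  2^-1 * (K + value (step c L true s w)) + 2^-1 * (K + value (step c L false s w)).

Let horizontal_average d X Y w : 0 <= Y <= L -> diry d = 0 :> R ->
  turn_average (d, (X, Y)) w =
  K + cos (phase X + om * dirx d * w) * mean Y.
Proof.
move=> Yin; rewrite /turn_average /step /alive /= Yin /value /=.
have [Y0 YL] := andP Yin.
have E : phase (X + c * w * dirx d) = phase X + om * dirx d * w.
  by rewrite phase_add /om; ring.
move=> d0; rewrite !d0 !mulr0 !addr0 !ltNge Y0 YL /= E.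
suff [[-> ->]|[-> ->]] : (turned true d = 1 /\ turned false d = 3) \/
               (turned true d = 3 /\ turned false d = 1).
- by rewrite /value_at /mean /=; field.
- by rewrite /value_at /mean /=; field.
move: d0; case: (Z4_cases d) => ->.
- by left; split; apply/val_inj.
- by move=> /eqP; rewrite oner_eq0.
- by right; split; apply/val_inj.
- by move=> /eqP; rewrite oppr_eq0 oner_eq0.
Qed.

(** The sine terms of the two horizontal directions are opposite, so that they
    disappear from the mean and only the factor kap remains. *)
Let vertical_average d X Y w : 0 <= Y <= L -> dirx d = 0 :> R ->
  turn_average (d, (X, Y)) w =
  let Y' := Y + c * w * diry d in
  K + (if Y' < 0 then cos (phase X) else if L < Y' then 0
       else cos (phase X) * (kap * mean Y')).
Proof.
move=> Yin; rewrite /turn_average /step /alive /= Yin /value /= => d0.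
rewrite d0 mulr0 addr0; set Y' := Y + _.
case: ifPn => _; first by field.
case: ifPn => _; first by field.
suff [[-> ->]|[-> ->]] : (turned true d = 0 /\ turned false d = 2) \/
               (turned true d = 2 /\ turned false d = 0).
- rewrite /value_at /dirx /= /kap.
  by field; rewrite gt_eqF.
- rewrite /value_at /dirx /= /kap.
  by field; rewrite gt_eqF.
move: d0; case: (Z4_cases d) => ->.
- by move=> /eqP; rewrite oner_eq0.
- by right; split; apply/val_inj.
- by move=> /eqP; rewrite oppr_eq0 oner_eq0.
- by left; split; apply/val_inj.
Qed.

Lemma measurable_turn_average s :
  measurable_fun (setT : set (measurableTypeR R)) (turn_average s).
Proof.
have ms b : measurable_fun (setT : set (measurableTypeR R))
    (fun w => K + value (step c L b s w)).
  apply: measurable_funD => //; apply: measurableT_comp measurable_value _.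
  exact: (measurable_fun_pair2 s (measurable_step c L b)).
by apply: measurable_funD; apply: measurable_funM => //; exact: ms.
Qed.

Variable nu : {measure set (measurableTypeR R) -> \bar R}.
Hypothesis nuE : forall A, measurable A -> nu A = exponential_prob lambda A.

(** Harmonicity of [value]. On horizontal legs the integral is the one of a
    damped oscillation; on vertical legs it is [integral_stopped] with G the
    solution g1 or g3 along the leg and l the time needed to reach the
    boundary, and the boundary conditions on g1 and g3 say that G l is the
    value after the exit. *)
Lemma integral_turn_average s :
  (\int[nu]_w (turn_average s w)%:E = (K + value s)%:E)%E.
Proof.
have ta_ge0 w : 0 <= turn_average s w.
  by rewrite addr_ge0// mulr_ge0 ?invr_ge0.
rewrite (ge0_integral_exponential lambda_gt0 nuE)//; last first.
  by apply/measurable_EFinP; exact: measurable_turn_average.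
under eq_integral do rewrite -EFinM.
have stopped := integral_stopped lambda_gt0 _ (measurable_turn_average s) ta_ge0.
case: s ta_ge0 stopped => d [X Y] ta_ge0 stopped.
have [Yin|] := boolP (0 <= Y <= L); last first.
  move=> Yout; pose v := value (d, (X, Y)).
  apply: (stopped (cst v) (cst v) _ 0) => //.
  - by move=> ?; exact: cvg_cst.
  - by move=> w; apply: is_derive_eq; rewrite /= subrr mulr0.
  - by move=> w _; rewrite /turn_average /step /alive /= (negbTE Yout) /v; field.
  - by move=> w _; rewrite /turn_average /step /alive /= (negbTE Yout) /v; field.
have [Y0 YL] := andP Yin.
have Y0F : (Y < 0) = false by rewrite ltNge Y0.
have YLF : (L < Y) = false by rewrite ltNge YL.
have horizontal : (d == 1) = false -> (d == 3) = false ->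
    diry d = 0 :> R -> dirx d ^+ 2 = 1 :> R ->
    (\int[@lebesgue_measure R]_(w in `[0%R, +oo[) (turn_average (d, (X, Y)) w *
       (lambda * expR (- (lambda * w))))%:E = (K + value (d, (X, Y)))%:E)%E.
  move=> d1F d3F d0 dd1; pose o := om * dirx d.
  have o2 : o ^+ 2 = om ^+ 2 by rewrite exprMn dd1 mulr1.
  under eq_integral do rewrite horizontal_average//.
  rewrite (integral_itvcy_is_derive (l := 0) _ _
    (fun w => is_derive_damped o (phase X) K (mean Y) w lambda_gt0)).
  - rewrite /damped_wave_primitive /value /= Y0F YLF /value_at d1F d3F; congr (_%:E).
    rewrite o2 !mulr0 oppr0 expR0 addr0 -/o.
    by field; rewrite gt_eqF.
  - move=> w _; rewrite -horizontal_average// mulr_ge0//.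
    by rewrite mulr_ge0 ?expR_ge0// ltW.
  - move=> w; apply: cvgM; last first.
      apply: cvgM; first exact: cvg_cst.
      exact: (is_derive_continuous (is_derive_expRM lambda)).
    apply: cvgD; first exact: cvg_cst.
    apply: cvgM; last exact: cvg_cst.
    exact: (is_derive_continuous (fun w => is_derive_comp_affine (is_derive_cos (phase X + o * w)))).
  - exact: cvgy_damped.
have cc : c != 0 by rewrite gt_eqF.
have cq (k : R) : continuous (fun w => cos (phase X) * (kap * mean (Y + k * w))).
  move=> w; apply: cvgM; first exact: cvg_cst.
  apply: cvgM; first exact: cvg_cst.
  apply: (@continuous_comp _ _ _ (fun w : R => Y + k * w) mean); last exact: cmean.
  exact: (is_derive_continuous (is_derive_affine Y k)).
case: (Z4_cases d) => dE; rewrite dE in ta_ge0 stopped horizontal *.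
- by apply: horizontal; rewrite ?/dirx ?/diry //= expr1n.
- have cl : c * ((L - Y) / c) = L - Y by field.
  have -> : value (1, (X, Y)) = cos (phase X) * g1 (Y + c * 0).
    by rewrite /value /= Y0F YLF /value_at /= mulr0 addr0.
  apply: (stopped (fun w => cos (phase X) * (kap * mean (Y + c * w)))
    (fun w => cos (phase X) * g1 (Y + c * w)) K ((L - Y) / c)) => //.
  + by rewrite divr_ge0 ?subr_ge0// ltW.
  + move=> w; have := is_derive_mull (cos (phase X)) (is_derive_comp_affine (dg1 (Y + c * w))).
    by move=> h; apply: is_derive_eq; field.
  + move=> w /andP[w0 wl]; rewrite vertical_average ?/dirx ?/diry //= mulr1.
    have cw : c * w <= L - Y by rewrite -cl ler_pM2l.
    have cw0 : 0 <= c * w by rewrite mulr_ge0// ltW.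
    rewrite ifF; last by apply/negbTE; rewrite -leNgt; lra.
    by rewrite ifF//; apply/negbTE; rewrite -leNgt; lra.
  + move=> w lw; rewrite vertical_average ?/dirx ?/diry //= mulr1 cl.
    have cw : L - Y < c * w by rewrite -cl ltr_pM2l.
    rewrite ifF; last by apply/negbTE; rewrite -leNgt; lra.
    rewrite ifT; last by lra.
    by rewrite (addrC Y) subrK g1_L mulr0.
- by apply: horizontal; rewrite ?/dirx ?/diry //= sqrrN expr1n.
- have cl : c * (Y / c) = Y by field.
  have -> : value (3, (X, Y)) = cos (phase X) * g3 (Y + - c * 0).
    by rewrite /value /= Y0F YLF /value_at /= mulr0 addr0.
  apply: (stopped (fun w => cos (phase X) * (kap * mean (Y + - c * w)))
    (fun w => cos (phase X) * g3 (Y + - c * w)) K (Y / c)) => //.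
  + by rewrite divr_ge0// ltW.
  + move=> w; have := is_derive_mull (cos (phase X)) (is_derive_comp_affine (dg3 (Y + - c * w))).
    by move=> h; apply: is_derive_eq; field.
  + move=> w /andP[w0 wl]; rewrite vertical_average ?/dirx ?/diry //= mulrN1 mulNr.
    have cw : c * w <= Y by rewrite -cl ler_pM2l.
    have cw0 : 0 <= c * w by rewrite mulr_ge0// ltW.
    rewrite ifF; last by apply/negbTE; rewrite -leNgt; lra.
    by rewrite ifF//; apply/negbTE; rewrite -leNgt; lra.
  + move=> w lw; rewrite vertical_average ?/dirx ?/diry //= mulrN1 mulNr cl.
    have cw : Y < c * w by rewrite -{1}cl ltr_pM2l.
    rewrite ifT; last by lra.
    by rewrite subrr g3_0 mulr1.
Qed.

End Value.

(** * The law of the corner chain *)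

(** The image of a measure is a measure only by a proof of measurability;
    this form carries the proof along. *)
Definition image_measure d d' (X : measurableType d) (Y : measurableType d')
    (R : realType) (mu : {measure set X -> \bar R}) (f : X -> Y)
    (mf : measurable_fun setT f) : {measure set Y -> \bar R}.
Proof. by refine (pushforward mu f : {measure set Y -> \bar R}). Defined.

Section Chain.
Context d {T : measurableType d} {R : realType} {P : probability T R} {lambda : R}.
Variables (M : motion_noise P lambda) (c L : R).

Fixpoint chain (s0 : state R) (n : nat) (w : T) : state R :=
  if n is n'.+1 then step c L (turn M n' w) (chain s0 n' w) (wait M n' w) else s0.

Lemma measurable_wait k : measurable_fun setT (wait M k).
Proof. exact: measurable_funPT. Qed.

Lemma measurable_chain s0 n : measurable_fun setT (chain s0 n).
Proof.
elim: n => [|n IH] /=; first exact: measurable_cst.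
have mS b : measurable_fun setT (fun w => step c L b (chain s0 n w) (wait M n w)).
  apply: (measurableT_comp (measurable_step c L b)
    (_ : measurable_fun setT (fun w => (chain s0 n w, wait M n w : measurableTypeR R)))).
  by apply: measurable_fun_pair; [exact: IH|exact: measurable_wait].
rewrite (_ : (fun _ => _) = fun w => if turn M n w
  then step c L true (chain s0 n w) (wait M n w)
  else step c L false (chain s0 n w) (wait M n w)); last first.
  by apply/funext => w; case: (turn M n w).
by apply: measurable_fun_ifT; [exact: measurable_funPT|exact: mS|exact: mS].
Qed.

HB.instance Definition _ s0 n :=
  isMeasurableFun.Build _ _ _ _ (chain s0 n) (measurable_chain s0 n).

Definition noise_sigma (i : option (nat + nat)) : set (set T) :=
  match i with
  | None => sigma_of (init M)
  | Some (inl k) => sigma_of (wait M k)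
  | Some (inr k) => sigma_of (turn M k)
  end.

Lemma noise_independent (J : {fset option (nat + nat)}) (F : option (nat + nat) -> set T) :
  (forall i, i \in J -> noise_sigma i (F i)) ->
  P (\bigcap_(i in [set` J]) F i) = (\prod_(i <- J) P (F i))%E.
Proof. exact: (@noise_indep _ _ _ _ _ M). Qed.

Lemma noise_sigma_measurable i A : noise_sigma i A -> measurable A.
Proof.
by case: i => [[k|k]|] /= [B mB <-]; apply: measurable_funP.
Qed.

Lemma noise_sigma_wait k (A : set R) :
  measurable A -> noise_sigma (Some (inl k)) (wait M k @^-1` A).
Proof. by move=> mA; exists A => //; rewrite setTI. Qed.

Lemma noise_sigma_turn k b : noise_sigma (Some (inr k)) (turn M k @^-1` [set b]).
Proof. by exists [set b] => //; rewrite setTI. Qed.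

Lemma noise_sigma_init j : noise_sigma None (init M @^-1` [set j]).
Proof. by exists [set j] => //; rewrite setTI. Qed.

(** Events about finitely many of the sources of randomness, in the product
    form for which independence is assumed. *)
Definition cylinder (J : {fset option (nat + nat)}) (E : set T) : Prop :=
  exists2 F : option (nat + nat) -> set T,
    forall i, i \in J -> noise_sigma i (F i) & E = \bigcap_(i in [set` J]) F i.

Lemma cylinder_setT : cylinder fset0 setT.
Proof.
exists (fun=> setT) => [i|]; first by rewrite inE.
by rewrite eqEsubset; split.
Qed.

Lemma cylinder_measurable J E : cylinder J E -> measurable E.
Proof.
move=> [F mF ->]; apply: fin_bigcap_measurable; first exact: finite_fset.
by move=> i /= iJ; apply: noise_sigma_measurable (mF _ iJ).
Qed.

Lemma cylinderI i J A E : i \notin J -> noise_sigma i A -> cylinder J E ->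
  cylinder (i |` J)%fset (A `&` E) /\ P (A `&` E) = (P A * P E)%E.
Proof.
move=> iJ mA [F mF EF].
pose F' k := if k == i then A else F k.
have mF' k : k \in (i |` J)%fset -> noise_sigma k (F' k).
  by rewrite /F' !inE; case: eqP => [->//|_] /= /mF.
have F'J k : k \in J -> F' k = F k.
  by rewrite /F'; case: eqP => [->|//]; rewrite (negbTE iJ).
have AE : A `&` E = \bigcap_(k in [set` (i |` J)%fset]) F' k.
  rewrite eqEsubset; split => w.
    move=> [Aw Ew] k /=; rewrite !inE /F'; case: eqP => //= _ kJ.
    by move: Ew; rewrite EF; apply.
  move=> H; split.
    by have := H i; rewrite /F' eqxx; apply; rewrite /= !inE eqxx.
  rewrite EF => k /= kJ; rewrite -(F'J _ kJ); apply: H.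
  by rewrite /= !inE kJ orbT.
split; first by exists F'.
rewrite AE noise_independent// big_fsetU1//= {1}/F' eqxx; congr (_ * _)%E.
rewrite EF noise_independent//; apply: eq_big_seq => k kJ.
by rewrite F'J.
Qed.

(** The sources that the chain has not used after n steps. The initial
    direction is among them since the chain starts from a fixed state. *)
Definition later (n : nat) (i : option (nat + nat)) : bool :=
  match i with None => true | Some (inl k) => (n <= k)%N | Some (inr k) => (n <= k)%N end.

Lemma laterW n i : later n.+1 i -> later n i.
Proof. by case: i => [[k|k]|//] /= /ltnW. Qed.

Variable nu : probability (measurableTypeR R) R.
Hypothesis nuE : forall A, measurable A -> nu A = exponential_prob lambda A.

Definition independent_of_later s0 n := forall (C : set (state R)) J E,
  measurable C -> cylinder J E -> (forall i, i \in J -> later n i) ->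
  P (chain s0 n @^-1` C `&` E) = (P (chain s0 n @^-1` C) * P E)%E.

Definition chain_wait s0 n (w : T) : state R * measurableTypeR R :=
  (chain s0 n w, wait M n w).

Lemma measurable_chain_wait s0 n : measurable_fun setT (chain_wait s0 n).
Proof.
by apply: measurable_fun_pair; [exact: measurable_chain|exact: measurable_wait].
Qed.

HB.instance Definition _ s0 n :=
  isMeasurableFun.Build _ _ _ _ (chain_wait s0 n) (measurable_chain_wait s0 n).

(** Conditioning on E yields a measure with the values of the product measure
    on rectangles: there, the wait can be counted among the later events. *)
Lemma chain_wait_law s0 n J E A : independent_of_later s0 n ->
  cylinder J E -> (forall i, i \in J -> later n i) -> Some (inl n) \notin J ->
  measurable A ->
  P (chain_wait s0 n @^-1` A `&` E) =
    ((distribution P (chain s0 n) \x nu) A * P E)%E.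
Proof.
move=> indep cE lE nJ mA; have mE := cylinder_measurable cE.
have PEfin : P E \is a fin_num by exact: fin_num_measure.
have mCA : measurable (chain_wait s0 n @^-1` A).
  by rewrite -[X in measurable X]setTI; exact: measurable_chain_wait.
have [PE0|PE0] := eqVneq (P E) 0%E.
  rewrite PE0 mule0; apply/eqP; rewrite eq_le measure_ge0 andbT -PE0.
  by apply: le_measure; rewrite ?inE//; exact: measurableI.
(* Normalised so that its marginals are the law of the state and [nu]. *)
pose k := (fine (P E))^-1.
have k0 : 0 <= k by rewrite invr_ge0 fine_ge0.
pose m' := mscale (NngNum k0) (image_measure (mrestr P mE) (measurable_chain_wait s0 n)).
have -> : ((distribution P (chain s0 n) \x nu) A = m' A)%E.
  apply: product_measure_unique => // C B mC mB.
  rewrite -[LHS]/(k%:E * P (chain_wait s0 n @^-1` (C `*` B) `&` E))%E.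
  have -> : chain_wait s0 n @^-1` (C `*` B) `&` E =
      chain s0 n @^-1` C `&` (wait M n @^-1` B `&` E).
    by rewrite setIA.
  have [cBE PBE] := cylinderI nJ (noise_sigma_wait n mB) cE.
  rewrite (indep _ _ _ mC cBE); last first.
    by move=> i; rewrite !inE => /predU1P[->//=|/lE].
  rewrite PBE (wait_exponential M)// -nuE// /distribution /pushforward.
  rewrite muleC -!muleA; congr (_ * _)%E.
  rewrite -[RHS]mule1; congr (_ * _)%E.
  rewrite -(fineK PEfin) -EFinM /k mulfV//.
  by rewrite fine_eq0.
rewrite -[m' A]/(k%:E * P (chain_wait s0 n @^-1` A `&` E))%E muleAC -[LHS]mul1e; congr (_ * _)%E.
rewrite -(fineK PEfin) -EFinM /k mulVf//.
by rewrite fine_eq0.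
Qed.

(** The next state is a function of the present state, of the next wait and of
    the next turn. Split according to the turn, which is a later event, and
    use the joint law of the state and the wait given by [chain_wait_law]. *)
Lemma chain_independent s0 n : independent_of_later s0 n.
Proof.
elim: n => [|n IH] C J E mC cE lE.
  have [sC|sC] := pselect (C s0).
    rewrite (_ : chain s0 0 @^-1` C = setT) ?setTI ?probability_setT ?mul1e//.
    by rewrite eqEsubset; split.
  rewrite (_ : chain s0 0 @^-1` C = set0) ?set0I ?measure0 ?mul0e//.
  by rewrite eqEsubset; split.
have split_turn J' E' : cylinder J' E' -> (forall i, i \in J' -> later n.+1 i) ->
  P (chain s0 n.+1 @^-1` C `&` E') =
  (((distribution P (chain s0 n) \x nu) [set p | C (step c L true p.1 p.2)] * (2^-1)%:E +
   (distribution P (chain s0 n) \x nu) [set p | C (step c L false p.1 p.2)] * (2^-1)%:E) * P E')%E.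
  move=> cE' lE'; have mE' := cylinder_measurable cE'.
  have tJ : Some (inr n) \notin J'.
    by apply/negP => /lE' /=; rewrite ltnn.
  have wJ : Some (inl n) \notin (Some (inr n) |` J')%fset.
    by rewrite !inE /=; apply/negP => /lE' /=; rewrite ltnn.
  have mS b : measurable [set p : state R * measurableTypeR R |
      C (step c L b p.1 p.2)].
    rewrite -[X in measurable X]setTI; exact: measurable_step.
  have part b : P (chain_wait s0 n @^-1` [set p | C (step c L b p.1 p.2)] `&`
      (turn M n @^-1` [set b] `&` E')) =
    ((distribution P (chain s0 n) \x nu) [set p | C (step c L b p.1 p.2)] *
      (2^-1)%:E * P E')%E.
    have [cT PT] := cylinderI tJ (noise_sigma_turn n b) cE'.
    rewrite (chain_wait_law IH cT _ wJ (mS b)) ?PT ?turn_fair ?muleA//.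
    by move=> i; rewrite !inE => /predU1P[->//=|/lE' /laterW].
  rewrite muleDl; [|exact: fin_num_measure|by rewrite ge0_adde_def ?inE ?mule_ge0].
  rewrite -!part -measureU//.
  - congr (P _); rewrite eqEsubset; split => w /=.
      by rewrite /chain_wait /=; case E1 : (turn M n w) => -[H1 H2]; [left|right].
    by rewrite /chain_wait /= => -[[H1 [-> H2]]|[H1 [-> H2]]].
  - apply: measurableI.
      by rewrite -[X in measurable X]setTI; exact: measurable_chain_wait.
    by apply: measurableI => //; exact: noise_sigma_measurable (noise_sigma_turn n _).
  - apply: measurableI.
      by rewrite -[X in measurable X]setTI; exact: measurable_chain_wait.
    by apply: measurableI => //; exact: noise_sigma_measurable (noise_sigma_turn n _).
  - by rewrite -subset0 => w [[_ [/= -> _]] [_ [/= ]]].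
rewrite (split_turn _ _ cE lE); congr (_ * _)%E.
have := split_turn _ _ cylinder_setT; rewrite setIT probability_setT mule1 => -> //.
Qed.

Lemma chain_law_rec s0 n C : measurable C ->
  P (chain s0 n.+1 @^-1` C) =
  ((2^-1)%:E * (distribution P (chain s0 n) \x nu) [set p | C (step c L true p.1 p.2)] +
   (2^-1)%:E * (distribution P (chain s0 n) \x nu) [set p | C (step c L false p.1 p.2)])%E.
Proof.
move=> mC.
have part b : P (chain_wait s0 n @^-1` [set p | C (step c L b p.1 p.2)] `&`
    (turn M n @^-1` [set b])) =
    ((2^-1)%:E * (distribution P (chain s0 n) \x nu) [set p | C (step c L b p.1 p.2)])%E.
  have [cT PT] := cylinderI (negbT (in_fset0 (Some (inr n)))) (noise_sigma_turn n b) cylinder_setT.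
  rewrite setIT probability_setT mule1 in cT PT.
  rewrite (chain_wait_law (@chain_independent s0 n) cT) ?turn_fair 1?muleC//.
  - by move=> i; rewrite in_fset1U in_fset0 orbF => /eqP -> /=.
  - by rewrite !inE.
  - rewrite -[X in measurable X]setTI; exact: measurable_step.
rewrite -!part -measureU//.
- congr (P _); rewrite eqEsubset; split => w /=.
    by rewrite /chain_wait /=; case E1 : (turn M n w) => H1; [left|right].
  by rewrite /chain_wait /= => -[[H1 ->]|[H1 ->]].
- apply: measurableI; last exact: noise_sigma_measurable (noise_sigma_turn n _).
  rewrite -[X in measurable X]setTI; apply: measurable_chain_wait => //.
  rewrite -[X in measurable X]setTI; exact: measurable_step.
- apply: measurableI; last exact: noise_sigma_measurable (noise_sigma_turn n _).
  rewrite -[X in measurable X]setTI; apply: measurable_chain_wait => //.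
  rewrite -[X in measurable X]setTI; exact: measurable_step.
- by rewrite -subset0 => w [[_ /= ->] [_ /=]].
Qed.

Lemma ge0_integral_chain_rec s0 n (f : state R -> R) :
  measurable_fun setT f -> (forall s, 0 <= f s) ->
  (\int[P]_w (f (chain s0 n.+1 w))%:E =
   \int[P]_w \int[nu]_v (2^-1 * f (step c L true (chain s0 n w) v) +
                         2^-1 * f (step c L false (chain s0 n w) v))%:E)%E.
Proof.
move=> mf f0; pose mu := (distribution P (chain s0 n) \x nu)%E.
have mEf : measurable_fun setT (EFin \o f) by exact/measurable_EFinP.
have half0 : (0 : R) <= 2^-1 by [].
pose mb b := mscale (NngNum half0) (image_measure mu (measurable_step c L b)).
have mfs b : measurable_fun setT
    (fun p : state R * measurableTypeR R => f (step c L b p.1 p.2)).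
  exact: measurableT_comp mf (measurable_step c L b).
transitivity (\int[distribution P (chain s0 n.+1)]_s (f s)%:E)%E.
  by rewrite (ge0_integral_distribution (chain s0 n.+1))// => s; rewrite lee_fin.
rewrite (eq_measure_integral (measure_add (mb true) (mb false))); last first.
  move=> C mC _; apply: etrans (esym (measure_addE (mb true) (mb false) C)).
  exact: chain_law_rec.
rewrite ge0_integral_measure_add//; last by move=> s _; rewrite lee_fin.
have mbE b : (\int[mb b]_s (f s)%:E =
    \int[mu]_p (2^-1 * f (step c L b p.1 p.2))%:E)%E.
  rewrite ge0_integral_mscale//; last by move=> s _; rewrite lee_fin.
  rewrite (ge0_integral_pushforward (measurable_step c L b))//; last first.
    by move=> s _; rewrite lee_fin.
  under [RHS]eq_integral do rewrite EFinM.
  rewrite ge0_integralZl//; last by move=> p _; rewrite lee_fin.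
  by apply/measurable_EFinP; exact: mfs.
rewrite !mbE -ge0_integralD//.
- under eq_integral do rewrite -EFinD.
  rewrite fubini_tonelli1.
  + rewrite (ge0_integral_distribution (chain s0 n))//.
    * apply: measurable_fun_fubini_tonelli_F => //.
        apply/measurable_EFinP; apply: measurable_funD; exact: measurable_funM.
      by move=> p; rewrite lee_fin addr_ge0// mulr_ge0.
    * move=> s; apply: integral_ge0 => v _.
      by rewrite lee_fin addr_ge0// mulr_ge0.
  + by apply/measurable_EFinP; apply: measurable_funD; exact: measurable_funM.
  + by move=> p; rewrite lee_fin addr_ge0// mulr_ge0.
- by move=> p _; rewrite lee_fin mulr_ge0.
- by apply/measurable_EFinP; exact: measurable_funM.
- by move=> p _; rewrite lee_fin mulr_ge0.
- by apply/measurable_EFinP; exact: measurable_funM.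
Qed.

(** The initial direction is independent of the chain, and its indicator is a
    density of the restriction of P to the corresponding event. *)
Lemma ge0_integral_chain_init s0 n j (f : state R -> R) :
  measurable_fun setT f -> (forall s, 0 <= f s) ->
  (\int[P]_w ((f (chain s0 n w))%:E * (\1_(init M @^-1` [set j]) w)%:E) =
   (4^-1)%:E * \int[P]_w (f (chain s0 n w))%:E)%E.
Proof.
move=> mf f0; have mI := noise_sigma_measurable (noise_sigma_init j).
have mEf : measurable_fun setT (EFin \o f) by exact/measurable_EFinP.
have quarter0 : (0 : R) <= 4^-1 by [].
rewrite -(@ge0_integral_density _ _ _ P (mrestr P mI) (\1_(init M @^-1` [set j]))).
- transitivity (\int[image_measure (mrestr P mI) (measurable_chain s0 n)]_s (f s)%:E)%E.
    rewrite (ge0_integral_pushforward (measurable_chain s0 n))//.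
    by move=> s _; rewrite lee_fin.
  rewrite (eq_measure_integral (mscale (NngNum quarter0) (distribution P (chain s0 n)))).
    rewrite ge0_integral_mscale//; last by move=> s _; rewrite lee_fin.
    by rewrite (ge0_integral_distribution (chain s0 n)).
  move=> C mC _.
  have [cI PI] := cylinderI (negbT (in_fset0 None)) (noise_sigma_init j) cylinder_setT.
  rewrite setIT probability_setT mule1 in cI PI.
  rewrite -[LHS]/(P (chain s0 n @^-1` C `&` init M @^-1` [set j])).
  rewrite (@chain_independent s0 n _ _ _ mC cI) ?init_uniform 1?muleC//.
  by move=> i; rewrite in_fset1U in_fset0 orbF => /eqP -> /=.
- by move=> w; rewrite indicE.
- exact: measurable_indic.
- move=> A mA; rewrite integral_indic//.
  by rewrite /mrestr setIC.
- apply/measurable_EFinP; exact: measurableT_comp mf (measurable_chain s0 n).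
- by move=> w; rewrite lee_fin.
Qed.

End Chain.

(** * Almost sure properties *)
Section AlmostSure.
Context d {T : measurableType d} {R : realType} {P : probability T R} {lambda : R}.
Variables (M : motion_noise P lambda) (c L : R).
Hypotheses (lambda_gt0 : 0 < lambda) (c_gt0 : 0 < c).
Variable nu : probability (measurableTypeR R) R.
Hypothesis nuE : forall A, measurable A -> nu A = exponential_prob lambda A.

Lemma wait_law k A : measurable A -> P (wait M k @^-1` A) = nu A.
Proof. by move=> mA; rewrite (wait_exponential M)// nuE. Qed.

Lemma ae_wait_gt0 : {ae P, forall w, forall k, 0 < wait M k w}.
Proof.
apply: ae_foralln => k; exists (wait M k @^-1` `]-oo, 0]%classic); split.
- by rewrite -[X in measurable X]setTI; apply: measurable_wait.
- apply: etrans (wait_law k _) _ => //; exact: exponential_le0 nuE.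
- by move=> w /= /negP; rewrite -leNgt in_itv.
Qed.

Lemma short_waits_cylinder a m n :
  exists2 J : {fset option (nat + nat)},
    (forall k, (m + n.*2 <= k)%N -> Some (inl k) \notin J) &
    cylinder M J [set w | forall i, (i < n)%N -> wait M (m + i.*2) w <= a] /\
    P [set w | forall i, (i < n)%N -> wait M (m + i.*2) w <= a] = (nu `]-oo, a]%classic ^+ n)%E.
Proof.
elim: n => [|n [J Jk [cJ PJ]]].
  exists fset0 => [//|]; rewrite (_ : [set w | _] = setT).
    by split; [exact: cylinder_setT|rewrite probability_setT].
  by rewrite eqEsubset; split.
have nJ := Jk _ (leqnn (m + n.*2)).
have ma : measurable (`]-oo, a]%classic : set R) by [].
have [c1 P1] := cylinderI nJ (noise_sigma_wait M (m + n.*2) ma) cJ.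
have E : [set w | forall i, (i < n.+1)%N -> wait M (m + i.*2) w <= a] =
  wait M (m + n.*2) @^-1` `]-oo, a]%classic `&`
  [set w | forall i, (i < n)%N -> wait M (m + i.*2) w <= a].
  rewrite eqEsubset; split => w /=; rewrite in_itv/=.
    by move=> H; split => [|i ni]; apply: H => //; exact: ltnW.
  move=> [H1 H2] i; rewrite ltnS leq_eqVlt => /predU1P[->//|]; exact: H2.
exists (Some (inl (m + n.*2)%N) |` J)%fset.
  move=> k kn; rewrite in_fset1U negb_or Jk ?andbT; last first.
    by apply: leq_trans kn; rewrite leq_add2l doubleS -addn2 leq_addr.
  apply/eqP => -[kE]; move: kn; rewrite kE doubleS -addn2 addnA.
  by rewrite leqNgt addn2 ltnS leqnSn.
rewrite E; split; first exact: c1.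
by rewrite P1 PJ wait_law// expeS.
Qed.

(** Every second leg is considered because vertical and horizontal legs
    alternate: some vertical leg will have to be long. *)
Lemma ae_long_wait a : 0 < a ->
  {ae P, forall w, forall m, exists i, a < wait M (m + i.*2) w}.
Proof.
move=> a0; apply: ae_foralln => m.
exists (\bigcap_n [set w | forall i, (i < n)%N -> wait M (m + i.*2) w <= a]).
have mE n : measurable [set w | forall i, (i < n)%N -> wait M (m + i.*2) w <= a].
  by have [J _ [cJ _]] := short_waits_cylinder a m n; exact: cylinder_measurable cJ.
split.
- exact: bigcap_measurable.
- apply/eqP; rewrite eq_le measure_ge0 andbT.
  set E := \bigcap_n _.
  pose q := 1 - expR (- (lambda * a)).
  have q0 : 0 <= q by rewrite subr_ge0 -[leRHS]expR0 ler_expR oppr_le0 mulr_ge0// ltW.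
  have q1 : q < 1 by rewrite ltrBlDr ltrDl expR_gt0.
  have PE n : (P E <= (q ^+ n)%:E)%E.
    have [J _ [_ PJ]] := short_waits_cylinder a m n.
    have -> : (q ^+ n)%:E = (nu `]-oo, a]%classic ^+ n)%E.
      by rewrite (exponential_le nuE)// EFin_expe.
    rewrite -PJ; apply: le_measure; rewrite ?inE//.
      exact: bigcap_measurable.
    by move=> w; apply.
  have qn : (fun n => (q ^+ n)%:E) @ \oo --> (0 : R)%:E.
    apply: cvg_EFin; first exact: nearW.
    by apply: cvg_expr; rewrite ger0_norm.
  apply: (@le_trans _ _ (limn (fun n => (q ^+ n)%:E))); last by rewrite (cvg_lim _ qn).
  apply: lime_ge; first exact: cvgP qn.
  exact: nearW.
- by move=> w /= /forallNP H n _ i _; have := H i; move/negP; rewrite -leNgt.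
Qed.


(** From a corner off the boundary, at most two durations of a vertical leg
    lead to the boundary, and the exponential law has no atoms. *)
Lemma ae_chain_off_boundary (s0 : state R) : 0 < s0.2.2 < L ->
  {ae P, forall w, forall n, (chain M c L s0 n w).2.2 != 0 /\ (chain M c L s0 n w).2.2 != L}.
Proof.
move=> /andP[y0 yL]; apply: ae_foralln => n.
pose C : set (state R) := [set s | s.2.2 = 0] `|` [set s | s.2.2 = L].
have mC : measurable C.
  apply: measurableU; rewrite -[X in measurable X]setTI.
    exact: (@measurable_ordinate R _ [set 0]).
  exact: (@measurable_ordinate R _ [set L]).
have mPC k : measurable (chain M c L s0 k @^-1` C).
  by rewrite -[X in measurable X]setTI; exact: measurable_chain.
suff PC : P (chain M c L s0 n @^-1` C) = 0%E.
  exists (chain M c L s0 n @^-1` C); split => // w /= /not_andP[] /negP;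
    rewrite negbK => /eqP; [by left|by right].
elim: n => [|n IH].
  rewrite (_ : _ @^-1` _ = set0) ?measure0// -subset0 => w [] /= E.
    by move: y0; rewrite E ltxx.
  by move: yL; rewrite E ltxx.
have mI : measurable_fun setT (\1_C : state R -> R) by exact: measurable_indic.
have I0 s : 0 <= (\1_C s : R) by rewrite indicE.
(* A vertical leg reaches ordinate 0 or L at one of these two times; with a
   horizontal leg the denominators vanish, but then the ordinate is unchanged. *)
have stepI s b v : (\1_C (step c L b s v) : R) <=
    \1_C s + ((\1_[set - s.2.2 / (c * diry s.1)] v + \1_[set (L - s.2.2) / (c * diry s.1)] v)).
  have I0' (A : set R) u : 0 <= (\1_A u : R) by rewrite indicE.
  rewrite {1}/step; case: ifPn => [al|_]; last by rewrite lerDl addr_ge0.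
  rewrite [X in X <= _]indicE; have [|_] := boolP (_ \in C); last by rewrite !addr_ge0.
  rewrite inE /C /=; have [->|d0] := eqVneq (diry s.1) (0 : R).
    rewrite mulr0 addr0 => sC; rewrite [X in X + _]indicE mem_set//=.
    by rewrite lerDl addr_ge0.
  have cd0 : c * diry s.1 != 0 by rewrite mulf_neq0// gt_eqF.
  case=> E.
    have -> : - s.2.2 / (c * diry s.1) = v.
      by apply: (mulIf cd0); rewrite divfK// -[LHS]add0r -E; ring.
    rewrite addrCA [X in X + _]indicE mem_set//=.
    by rewrite lerDl addr_ge0.
  have -> : (L - s.2.2) / (c * diry s.1) = v.
    by apply: (mulIf cd0); rewrite divfK// -E; ring.
  rewrite addrA addrC [X in X + _]indicE mem_set//=.
  by rewrite lerDl addr_ge0.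
apply/eqP; rewrite eq_le measure_ge0 andbT.
have -> : P (chain M c L s0 n.+1 @^-1` C) =
    (\int[P]_w (\1_C (chain M c L s0 n.+1 w))%:E)%E.
  by rewrite -[RHS]/(\int[P]_w (\1_(chain M c L s0 n.+1 @^-1` C) w)%:E)%E integral_indic// setIT.
rewrite (ge0_integral_chain_rec M c L nuE)//.
have mavg s : measurable_fun (setT : set (measurableTypeR R)) (fun v =>
   (2^-1 * (\1_C (step c L true s v) : R) + 2^-1 * \1_C (step c L false s v))).
  by apply: measurable_funD; apply: measurable_funM => //;
    apply: (measurableT_comp mI); exact: (measurable_fun_pair2 s (measurable_step c L _)).
have inner s : (\int[nu]_v (2^-1 * \1_C (step c L true s v) +
                  2^-1 * \1_C (step c L false s v))%:E <= (\1_C s)%:E)%E.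
  pose a := - s.2.2 / (c * diry s.1); pose b := (L - s.2.2) / (c * diry s.1).
  have m1 (z : R) : measurable_fun (setT : set (measurableTypeR R))
     (fun v => (\1_[set z] v)%:E : \bar R).
    by apply/measurable_EFinP; exact: measurable_indic.
  have I0' (A : set R) u : 0 <= (\1_A u : R) by rewrite indicE.
  have nz (z : R) : (\int[nu]_v (\1_[set z] v)%:E = 0)%E.
    by rewrite integral_indic// setIT; exact: exponential_null1 nuE z.
  apply: (@le_trans _ _ (\int[nu]_v ((\1_C s)%:E + ((\1_[set a] v)%:E + (\1_[set b] v)%:E)))%E).
    apply: ge0_le_integral => //.
    - by apply/measurable_EFinP; exact: mavg.
    - by apply: emeasurable_funD => //; exact: emeasurable_funD.
    - move=> v _; rewrite -!EFinD lee_fin.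
      by have := stepI s true v; have := stepI s false v; rewrite -/a -/b; lra.
  rewrite ge0_integralD//; last 2 first.
    by move=> v _; rewrite adde_ge0// lee_fin.
    exact: emeasurable_funD.
  rewrite ge0_integralD//.
  rewrite !nz !adde0 integral_cst// -[leRHS]mule1 lee_wpmul2l ?lee_fin//.
  exact: probability_le1.
apply: (@le_trans _ _ (\int[P]_w (\1_C (chain M c L s0 n w))%:E)%E); last first.
  rewrite -[X in (X <= _)%E]/(\int[P]_w (\1_(chain M c L s0 n @^-1` C) w)%:E)%E.
  by rewrite integral_indic// setIT le_eqVlt; apply/orP; left; apply/eqP; exact: IH.
apply: ge0_le_integral => //.
- by move=> w _; apply: integral_ge0 => v _; rewrite lee_fin addr_ge0// mulr_ge0.
- apply: (measurableT_comp (f := fun s => (\int[nu]_v (2^-1 * \1_C (step c L true s v) +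
                  2^-1 * \1_C (step c L false s v))%:E)%E)); last exact: measurable_chain.
  apply: (@measurable_fun_fubini_tonelli_F _ _ _ _ _ nu (fun p : state R * measurableTypeR R =>
    (2^-1 * \1_C (step c L true p.1 p.2) + 2^-1 * \1_C (step c L false p.1 p.2))%:E)).
    apply/measurable_EFinP; apply: measurable_funD; apply: measurable_funM => //;
    by apply: (measurableT_comp mI); exact: measurable_step.
  by move=> p; rewrite lee_fin addr_ge0// mulr_ge0.
- by apply/measurable_EFinP; apply: (measurableT_comp mI); exact: measurable_chain.
Qed.

End AlmostSure.

(** * Expectations along the chain *)
Section NullSet.
Context d {T : measurableType d} {R : realType}.
Variable mu : {measure set T -> \bar R}.

Import HBNNSimple.

(** Holds for non-measurable functions as well: a simple function below f can
    be set to zero on N without changing its integral, so that both integrals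
    are suprema over the same values. *)
Lemma integral_null_restrict (N : set T) (f : T -> \bar R) : measurable N ->
  mu N = 0%E -> (\int[mu]_x f x = \int[mu]_x (f \_ (~` N)) x)%E.
Proof.
move=> mN N0.
have mNC : measurable (~` N) by exact: measurableC.
have sup_eq (g : T -> \bar R) : (forall x, 0 <= g x)%E ->
  ereal_sup [set sintegral mu h |
    h in [set h : {nnsfun T >-> R} | forall x, ((h x)%:E <= g x)%E]] =
  ereal_sup [set sintegral mu h |
    h in [set h : {nnsfun T >-> R} | forall x, ((h x)%:E <= (g \_ (~` N)) x)%E]].
  move=> g0; apply/eqP; rewrite eq_le; apply/andP; split; apply: ub_ereal_sup => _ [h /= hg <-].
    apply: ereal_sup_ubound; exists (proj_nnsfun h mNC) => [x|].
      rewrite /= patchE; case: ifPn => xN.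
        by rewrite /= mindicE xN mulr1.
      by rewrite /= mindicE (negbTE xN) mulr0.
    rewrite -!integralT_nnsfun; apply: ge0_ae_eq_integral => //.
    - exact/measurable_EFinP.
    - exact/measurable_EFinP.
    - by move=> x _; rewrite lee_fin.
    - by move=> x _; rewrite lee_fin.
    exists N; split => // x /= /not_implyP[_].
    apply: contra_notP => xN; rewrite /= mindicE mem_set ?mulr1//.
  apply: ereal_sup_ubound; exists h => // x.
  by apply: le_trans (hg x) _; rewrite patchE; case: ifPn.
rewrite /integral !patch_setT; congr (_ - _)%E.
  by rewrite sup_eq// funepos_restrict.
by rewrite sup_eq// funeneg_restrict.
Qed.

End NullSet.

Section Martingale.
Context d {T : measurableType d} {R : realType} {P : probability T R} {lambda : R}.
Variables (M : motion_noise P lambda) (c L alpha beta x0 : R) (g1 g3 : R -> R).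
Hypotheses (lambda_gt0 : 0 < lambda) (c_gt0 : 0 < c) (L_gt0 : 0 < L).
Variable nu : probability (measurableTypeR R) R.
Hypothesis nuE : forall A, measurable A -> nu A = exponential_prob lambda A.
Let kap := lambda ^+ 2 / (lambda ^+ 2 + (alpha * c) ^+ 2).
Let mean y := (g1 y + g3 y) / 2.
Hypothesis dg1 : forall y : R, is_derive y 1 g1 (lambda * (g1 y - kap * mean y) / c).
Hypothesis dg3 : forall y : R, is_derive y 1 g3 (lambda * (kap * mean y - g3 y) / c).
Hypotheses (g1_L : g1 L = 0) (g3_0 : g3 0 = 1).

Local Notation val := (value lambda c L alpha beta x0 g1 g3).
Local Notation Z := (chain M c L).
Local Notation I j := (init M @^-1` [set j]).

Let measurable_val : measurable_fun setT val.
Proof. exact: measurable_value dg1 dg3. Qed.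

Lemma integral_value_chain K s0 n : (forall s, 0 <= K + val s) ->
  (\int[P]_w (K + val (Z s0 n w))%:E = (K + val s0)%:E)%E.
Proof.
move=> K0; elim: n => [|n IH] /=.
  rewrite integral_cst// -[RHS]mule1; congr (_ * _)%E; exact: probability_setT.
rewrite (ge0_integral_chain_rec M c L nuE s0 n (f := fun s => K + val s))//; last first.
  exact: measurable_funD.
rewrite -IH; apply: eq_integral => w _.
apply: etrans (integral_turn_average lambda_gt0 c_gt0 dg1 dg3 g1_L g3_0 K0 nuE (Z s0 n w)).
by apply: eq_integral => v _.
Qed.

(** The shift by K is removed again by linearity, everything being bounded. *)
Lemma integral_value_chain_init s0 n j :
  (\int[P]_w (val (Z s0 n w) * \1_(I j) w)%:E = (4^-1 * val s0)%:E)%E.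
Proof.
have [K valK] := bounded_value beta x0 lambda_gt0 L_gt0 dg1 dg3.
have K0 s : 0 <= K + val s by have := valK s; rewrite ler_norml; lra.
have Kge0 : 0 <= K by exact: le_trans (valK s0).
have mI : measurable (I j) := noise_sigma_measurable (noise_sigma_init M j).
have mIj : measurable_fun setT (\1_(I j) : T -> R) by exact: measurable_indic.
have mvZ : measurable_fun setT (fun w => val (Z s0 n w)).
  exact: measurableT_comp measurable_val (measurable_chain M c L s0 n).
have PI : (\int[P]_w (K * \1_(I j) w)%:E = (4^-1 * K)%:E)%E.
  under eq_integral do rewrite EFinM.
  rewrite ge0_integralZl//; last by exact/measurable_EFinP.
  rewrite integral_indic// setIT.
  by apply: etrans (congr1 (mule K%:E) (init_uniform M j)) _; rewrite -EFinM mulrC.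
have := ge0_integral_chain_init M c L nuE s0 n j
  (measurable_funD (measurable_cst K) measurable_val) K0.
rewrite integral_value_chain// -EFinM => E.
have bI w : 0 <= (\1_(I j) w : R) <= 1.
  by rewrite indicE; case: (_ \in _); rewrite /= ?ler01 ?lexx.
have int (f : T -> R) B : measurable_fun setT f -> (forall w, `|f w| <= B) ->
    P.-integrable setT (EFin \o f).
  move=> mf fB; apply: measurable_bounded_integrable => //.
    exact: le_lt_trans (probability_le1 P measurableT) (ltry 1).
  exists B; split; first exact: num_real.
  by move=> b Bb w _ /=; rewrite (le_trans (fB w))// ltW.
have -> : (\int[P]_w (val (Z s0 n w) * \1_(I j) w)%:E =
  \int[P]_w (((K + val (Z s0 n w)) * \1_(I j) w)%:E - (K * \1_(I j) w)%:E))%E.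
  by apply: eq_integral => w _; rewrite -EFinB; congr (_%:E); ring.
rewrite integralB_EFin//.
- rewrite PI; under eq_integral do rewrite EFinM.
  by rewrite E -EFinB; congr (_%:E); ring.
- apply: (int _ (K + K)); first by apply: measurable_funM => //; exact: measurable_funD.
  move=> w; have /andP[b0 b1] := bI w.
  rewrite normrM (ger0_norm b0) (le_trans (ler_piMr _ b1))//.
  by rewrite (le_trans (ler_normD _ _))// (ger0_norm Kge0) lerD2l.
- apply: (int _ K); first exact: measurable_funM.
  move=> w; have /andP[b0 b1] := bI w.
  by rewrite normrM (ger0_norm b0) (ger0_norm Kge0) ler_piMr.
Qed.

(** Dominated convergence for the functions [value] along the chain, put to
    zero on the exceptional set. Their expectations do not depend on n, and
    f agrees with their limit off that set. *)
Lemma expectation_eventually_value (f : T -> R) s0 j :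
  {ae P, forall w, exists N, forall n, (N <= n)%N ->
     f w = val (Z s0 n w) * \1_(I j) w} ->
  ('E_P[f] = (4^-1 * val s0)%:E)%E.
Proof.
move=> [N [mN N0 Nbad]]; rewrite expectation.unlock.
rewrite (integral_null_restrict _ mN N0).
have [K valK] := bounded_value beta x0 lambda_gt0 L_gt0 dg1 dg3.
have mI : measurable (I j) := noise_sigma_measurable (noise_sigma_init M j).
have mNC : measurable (~` N) by exact: measurableC.
pose h n w := val (Z s0 n w) * \1_(I j) w * \1_(~` N) w.
have mh0 n : measurable_fun setT (fun w => val (Z s0 n w) * \1_(I j) w).
  apply: measurable_funM; last exact: measurable_indic.
  exact: measurableT_comp measurable_val (measurable_chain M c L s0 n).
have mh n : measurable_fun setT (h n).
  by apply: measurable_funM; [exact: mh0|exact: measurable_indic].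
have hcvg w : (h n w)%:E @[n --> \oo] --> ((fun w => (f w)%:E) \_ (~` N)) w.
  rewrite patchE; case: ifPn => wN; last first.
    rewrite (_ : (fun _ => _) = cst 0%E); first exact: cvg_cst.
    by apply/funext => n; rewrite /h [\1_(~` N) w]indicE (negbTE wN) mulr0.
  have [N1 fN1] : exists N, forall n, (N <= n)%N ->
     f w = val (Z s0 n w) * \1_(I j) w.
    apply: contrapT => bad; move: wN; rewrite inE; apply; exact: Nbad.
  apply: (@cvg_near_cst _ _ _ _ _ _ _); exists N1 => // n /= N1n.
  by rewrite /h [\1_(~` N) w]indicE wN mulr1 (fN1 _ N1n).
have hint n : (\int[P]_w (h n w)%:E = (4^-1 * val s0)%:E)%E.
  rewrite -(integral_value_chain_init s0 n j); apply: ae_eq_integral => //.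
  - exact/measurable_EFinP.
  - exact/measurable_EFinP.
  exists N; split => // w /= /not_implyP[_]; apply: contra_notP => wN.
  by rewrite /h [\1_(~` N) w]indicE mem_set// mulr1.
have hK n w : (`|(h n w)%:E| <= K%:E)%E.
  have bI (A : set T) : 0 <= (\1_A w : R) <= 1.
    by rewrite indicE; case: (_ \in _); rewrite /= ?ler01 ?lexx.
  have /andP[a0 a1] := bI (I j); have /andP[b0 b1] := bI (~` N).
  rewrite lee_fin !normrM (ger0_norm a0) (ger0_norm b0).
  by rewrite (le_trans (ler_piMr _ b1)) ?mulr_ge0// (le_trans (ler_piMr _ a1)).
have := @dominated_cvg _ _ _ P setT measurableT (fun n w => (h n w)%:E)
  ((fun w => (f w)%:E) \_ (~` N)) (cst K%:E).
have -> : (fun n => \int[P]_w (h n w)%:E)%E = cst (4^-1 * val s0)%:E.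
  by apply/funext => n; rewrite hint.
move=> dc; apply/esym.
have {dc} : cst (4^-1 * val s0)%:E @ \oo --> (\int[P]_w ((fun w => (f w)%:E) \_ (~` N)) w)%E.
  apply: dc => //.
  - by move=> n; exact/measurable_EFinP.
  - by apply: finite_measure_integrable_cst.
by move=> /cvg_lim <-//; rewrite lim_cst.
Qed.

End Martingale.

(** * The path of the particle and its exit from the strip *)
Section Path.
Context d {T : measurableType d} {R : realType} {P : probability T R} {lambda : R}.
Variables (M : motion_noise P lambda) (c L x y : R) (w : T).
Hypothesis c_gt0 : 0 < c.
Hypothesis wait_gt0 : forall k, 0 < wait M k w.
Hypothesis long_wait : forall m, exists i, L / c < wait M (m + i.*2) w.

Local Notation tau_ n := (arrival M n w).

Definition heading n : 'Z_4 := init M w + \sum_(k < n) (if turn M k w then 1 else -1).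

Lemma headingS n : heading n.+1 = turned (turn M n w) (heading n).
Proof. by rewrite /heading big_ord_recr /= addrA. Qed.

Lemma arrivalS n : tau_ n.+1 = tau_ n + wait M n w.
Proof. by rewrite /arrival big_ord_recr. Qed.

Lemma arrival0 : tau_ 0 = 0.
Proof. by rewrite /arrival big_ord0. Qed.

Lemma arrival_le m n : (m <= n)%N -> tau_ m <= tau_ n.
Proof.
move=> /subnK <-; elim: (n - m)%N => [|k IH]; first by rewrite add0n.
by rewrite addSn arrivalS (le_trans IH)// lerDl ltW.
Qed.

Lemma arrival_ge0 n : 0 <= tau_ n.
Proof. by rewrite -arrival0 arrival_le. Qed.

Lemma arrival_bracket t n : 0 <= t < tau_ n ->
  exists2 k, (k < n)%N & tau_ k <= t < tau_ k.+1.
Proof.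
elim: n => [|n IH] /andP[t0 tn]; first by move: tn; rewrite arrival0 ltNge t0.
have [tn'|tn'] := ltP t (tau_ n).
  have [|k kn kt] := IH; first by rewrite t0.
  by exists k => //; exact: ltnW.
by exists n => //; rewrite tn'.
Qed.

Lemma event_countE n t : tau_ n <= t < tau_ n.+1 -> event_count M t w = n.
Proof.
move=> /andP[nt tn]; rewrite /event_count; apply: card_fset_set.
rewrite (_ : [set _ | _] = `I_n); first exact: card_eqxx.
rewrite eqEsubset; split => k /= h.
  rewrite ltnNge; apply/negP => nk.
  by move: tn; rewrite ltNge (le_trans _ h)// arrival_le.
by rewrite (le_trans _ nt)// arrival_le.
Qed.

Lemma direction_atE n t : tau_ n <= t < tau_ n.+1 -> direction_at M t w = heading n.
Proof. by move=> tn; rewrite /direction_at (event_countE tn). Qed.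

Section HeadingIntegral.
Variable phi : 'Z_4 -> R.
Hypothesis phi_le1 : forall e, `|phi e| <= 1.
Local Notation leb := (@lebesgue_measure R).
Let f s := phi (direction_at M s w).

Let measurable_f n : measurable_fun (`[0, tau_ n[%classic : set R) f.
Proof.
elim: n => [|n IH].
  rewrite arrival0 set_itvco0; exact: measurable_fun_set0.
have -> : (`[0, tau_ n.+1[%classic : set R) = `[0, tau_ n[%classic `|` `[tau_ n, tau_ n.+1[%classic.
  by rewrite -itv_bndbnd_setU// bnd_simp ?arrival_ge0 ?arrival_le.
apply/measurable_funU => //; split => //.
apply: (eq_measurable_fun (cst (phi (heading n)))); last exact: measurable_cst.
by move=> s; rewrite inE/= in_itv/= => sn; rewrite /f (direction_atE sn).
Qed.

Let integrable_f n t : t <= tau_ n -> leb.-integrable `[0, t[ (EFin \o f).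
Proof.
move=> tn; apply: measurable_bounded_integrable => //.
- suff : (leb (`[0%R, t[%classic : set R) < +oo)%E by [].
  rewrite lebesgue_measure_itv /=; case: ifPn => _; last exact: ltry.
  by rewrite -EFinD ltry.
- have mf : measurable_fun (`[0, t[%classic : set R) f.
    have sub : (`[0, t[%classic : set R) `<=` `[0, tau_ n[%classic.
      by apply: subset_itvl; rewrite bnd_simp.
    exact: (measurable_funS (measurable_itv `[0, tau_ n[) sub (@measurable_f n)).
  exact: mf.
- exists 1; split; first exact: num_real.
  by move=> b b1 s _ /=; rewrite (le_trans (phi_le1 _))// ltW.
Qed.

(** Stated for an arbitrary bounded function of the direction, in order to
    cover both coordinates of the velocity. *)
Lemma integral_heading n t : tau_ n <= t <= tau_ n.+1 ->
  \int[leb]_(s in `[0, t]) phi (direction_at M s w) =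
  \int[leb]_(s in `[0, tau_ n]) phi (direction_at M s w) + (t - tau_ n) * phi (heading n).
Proof.
move=> /andP[nt tn].
have t0 : 0 <= t by rewrite (le_trans _ nt)// arrival_ge0.
rewrite -Rintegral_itv_bndo_bndc; last exact: integrable_f tn.
rewrite -[in RHS]Rintegral_itv_bndo_bndc; last exact: (integrable_f (n := n)).
have U : (`[0, t[%classic : set R) = `[0, tau_ n[%classic `|` `[tau_ n, t[%classic.
  by rewrite -itv_bndbnd_setU// bnd_simp ?arrival_ge0.
rewrite {1}U Rintegral_setU//; last 2 first.
- by rewrite -U; exact: integrable_f tn.
- rewrite disj_set2E; apply/eqP; rewrite -subset0 => s [] /=; rewrite !in_itv/=.
  by move=> /andP[_ sn] /andP[/(lt_le_trans sn)]; rewrite ltxx.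
congr (_ + _).
rewrite (@eq_Rintegral _ _ _ leb _ (cst (phi (heading n)))); last first.
  move=> s; rewrite inE/= in_itv/= => /andP[ns st].
  by rewrite (@direction_atE n)// ns (lt_le_trans st).
rewrite Rintegral_cst// mulrC; congr (_ * _).
suff : fine (leb (`[tau_ n, t[%classic : set R)) = t - tau_ n by [].
rewrite lebesgue_measure_itv/= lte_fin; case: ltP => //= tn'.
by rewrite (@le_anti _ _ t (tau_ n)) ?subrr// tn' nt.
Qed.

End HeadingIntegral.

(** Locked, because simplification would otherwise project through the pair
    and expose the integrals that define the position. *)
Definition corner n : R * R := locked (position M c x y (tau_ n) w).

Lemma positionE n t : tau_ n <= t <= tau_ n.+1 -> position M c x y t w =
  ((corner n).1 + c * (t - tau_ n) * dirx (heading n),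
   (corner n).2 + c * (t - tau_ n) * diry (heading n)).
Proof.
move=> tn; rewrite /corner -lock /position /=.
have E1 : (fun s => (direction (direction_at M s w)).1) =
    (fun s => dirx (direction_at M s w)) :> (R -> R).
  by apply/funext => s; rewrite directionE.
have E2 : (fun s => (direction (direction_at M s w)).2) =
    (fun s => diry (direction_at M s w)) :> (R -> R).
  by apply/funext => s; rewrite directionE.
rewrite E1 E2 (integral_heading (@normr_dirx_le1 R) tn) (integral_heading (@normr_diry_le1 R) tn).
by congr (_, _); ring.
Qed.

Lemma corner0 : corner 0 = (x, y).
Proof.
by rewrite /corner -lock arrival0 /position set_itv1 !Rintegral_set1 mulr0 !addr0.
Qed.

Lemma cornerS n : corner n.+1 =
  ((corner n).1 + c * wait M n w * dirx (heading n),
   (corner n).2 + c * wait M n w * diry (heading n)).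
Proof.
rewrite {1}/corner -lock (@positionE n); last first.
  by rewrite lexx andbT arrivalS lerDl ltW.
by rewrite arrivalS (addrC (tau_ n)) addrK.
Qed.

Local Notation Z := (chain M c L (init M w, (x, y))).

Lemma chain_corner n : (forall k, (k < n)%N -> alive L (Z k w)) ->
  Z n w = (heading n, corner n).
Proof.
elim: n => [|n IH] al /=; first by rewrite corner0 /heading big_ord0 addr0.
have Zn : Z n w = (heading n, corner n) by apply: IH => k kn; apply: al; exact: ltnW.
have := al n (ltnSn n); rewrite /step Zn => -> /=.
by rewrite headingS cornerS.
Qed.

Lemma diry_turned2 b b' (e : 'Z_4) :
  (diry (turned b' (turned b e)) == 0 :> R) = (diry e == 0 :> R).
Proof.
have n1 : (-1 == 0 :> R) = false by rewrite oppr_eq0 oner_eq0.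
by case: (Z4_cases e) => ->; case: b; case: b'; rewrite /diry /= ?eqxx ?oner_eq0 ?n1.
Qed.

Lemma diry_turned b (e : 'Z_4) : diry e = 0 :> R -> diry (turned b e) != 0 :> R.
Proof.
have n1 : -1 != 0 :> R by rewrite oppr_eq0 oner_eq0.
by case: (Z4_cases e) => ->; case: b; rewrite /diry /= ?oner_eq0 ?n1 // => /eqP;
  rewrite ?oner_eq0 ?(negbTE n1).
Qed.

(** The direction is vertical at every second corner, and one of the waits
    there exceeds L / c. *)
Lemma eventually_exits : exists n, ~~ alive L (Z n w).
Proof.
apply: contrapT => /forallNP al0.
have al n : alive L (Z n w) by apply: contrapT => /negP; exact: al0.
have Zn n : Z n w = (heading n, corner n) by apply: chain_corner.
have [m hm] : exists m, diry (heading m) != 0 :> R.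
  have [h0|h0] := eqVneq (diry (heading 0)) (0 : R); last by exists 0%N.
  by exists 1%N; rewrite headingS diry_turned.
have hmi i : diry (heading (m + i.*2)) != 0 :> R.
  elim: i => [|i IH]; first by rewrite addn0.
  by rewrite doubleS !addnS !headingS diry_turned2.
have [i iH] := long_wait m; have := hmi i.
have := al (m + i.*2)%N; have := al (m + i.*2).+1; rewrite !Zn /alive/= cornerS /=.
have cw : L < c * wait M (m + i.*2) w by rewrite mulrC -ltr_pdivrMr.
rewrite /diry; case: ifP => _ /=; first by lra.
case: ifP => _ /=; first by lra.
by rewrite eqxx.
Qed.

Hypothesis y_in : 0 < y < L.
Hypothesis off_boundary : forall n, (Z n w).2.2 != 0 /\ (Z n w).2.2 != L.

Lemma exit_time_eq (t0 t1 : R) : 0 < t0 -> t0 < t1 ->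
  (forall t, 0 < t <= t0 -> strip L (position M c x y t w)) ->
  (forall t, t0 < t < t1 -> ~ strip L (position M c x y t w)) ->
  exit_time M c L x y w = t0%:E.
Proof.
move=> t00 t01 inside outside; rewrite /exit_time; apply/eqP; rewrite eq_le; apply/andP; split.
  apply/lee_addgt0Pr => e e0; pose t := Num.min (t0 + e) ((t0 + t1) / 2).
  have tt : t0 < t < t1.
    rewrite lt_min gt_min ltrDl e0/= [X in _ || X](_ : _ = true) ?orbT; last by lra.
    by rewrite andbT; lra.
  apply: (@le_trans _ _ t%:E).
    apply: ereal_inf_lbound; exists t => //; split; last exact: outside.
    by case/andP: tt => /(lt_trans t00).
  by rewrite -EFinD lee_fin ge_min lexx.
apply: le_ereal_inf_tmp => _ [t [tp tout] <-]; rewrite lee_fin leNgt; apply/negP => tt0.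
by apply: tout; apply: inside; rewrite tp ltW.
Qed.

(** Let N + 1 be the index of the first corner outside the strip. All corners
    up to N are in the open strip, so that leg N is vertical and the particle
    is in the strip until the moment, strictly inside that leg, at which it
    reaches the boundary; right after it is outside. The abscissa is constant
    on this leg. *)
Lemma exit_chain : exists n, ~~ alive L (Z n w) /\
  exit_time M c L x y w \is a fin_num /\
  (exit_point M c L x y w).1 = (Z n w).2.1 /\
  ((exit_point M c L x y w).2 = 0 <-> (Z n w).2.2 < 0).
Proof.
have [ep epE] : exists p, p = exit_point M c L x y w by exists (exit_point M c L x y w).
rewrite -epE; have [n nal nmin] := ex_minnP eventually_exits.
case: n => [|N] in nal nmin *.
  move: nal; rewrite /alive /= => /negP[].
  by case/andP: y_in => /ltW -> /ltW ->.
have al k : (k <= N)%N -> alive L (Z k w).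
  by move=> kN; apply/negPn/negP => /nmin; rewrite leqNgt ltnS kN.
have Zk k : (k <= N.+1)%N -> Z k w = (heading k, corner k).
  by move=> kN; apply: chain_corner => i ik; apply: al; rewrite -ltnS (leq_trans ik).
have inS k : (k <= N)%N -> 0 < (corner k).2 < L.
  move=> kN; have := al _ kN; have [] := off_boundary k; rewrite (Zk _ (leqW kN)) /alive /=.
  by move=> k0 kL /andP[? ?]; rewrite !lt_neqAle eq_sym k0 kL /=; apply/andP.
exists N.+1; split => //; rewrite (Zk _ (leqnn _)) /=.
move: nal; rewrite (Zk _ (leqnn _)) /alive /= cornerS /=.
set X := (corner N).1; set Y := (corner N).2; set W := wait M N w.
have YN : 0 < Y < L := inS _ (leqnn N).
have W0 : 0 < W := wait_gt0 N.
have cW : 0 < c * W by rewrite mulr_gt0.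
have before k t : (k < N)%N -> tau_ k <= t <= tau_ k.+1 -> strip L (position M c x y t w).
  move=> kN kt; rewrite (positionE kt) /strip /=.
  have := inS _ (ltnW kN); have := inS _ kN; rewrite cornerS /=.
  have h0 : 0 <= c * (t - tau_ k).
    by rewrite mulr_ge0 ?(ltW c_gt0)// subr_ge0; case/andP: kt.
  have h1 : c * (t - tau_ k) <= c * wait M k w.
    by rewrite ler_pM2l// lerBlDl -arrivalS; case/andP: kt.
  by rewrite /diry; case: ifP => _; [|case: ifP => _]; lra.
have finish (h : R) : 0 < h < W -> dirx (heading N) = 0 :> R ->
    (forall u, 0 <= u <= h -> 0 <= Y + c * u * diry (heading N) <= L) ->
    (forall u, h < u < W -> ~ (0 <= Y + c * u * diry (heading N) <= L)) ->
    exit_time M c L x y w \is a fin_num /\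
    ep = (X, Y + c * h * diry (heading N)).
  move=> /andP[h0 hW] dx0 hin hout.
  have taulast t : tau_ N <= t <= tau_ N + W -> position M c x y t w =
      (X, Y + c * (t - tau_ N) * diry (heading N)).
    by move=> tN; rewrite (@positionE N) ?arrivalS// dx0 mulr0 addr0.
  have E : exit_time M c L x y w = (tau_ N + h)%:E.
    apply: (@exit_time_eq _ (tau_ N + W)).
    - by rewrite ltr_wpDl// arrival_ge0.
    - by rewrite ltrD2l.
    - move=> t /andP[t0 th]; have [tN|tN] := ltP t (tau_ N).
        have [|k kN /andP[kt tk]] := @arrival_bracket t N; first by rewrite (ltW t0).
        by apply: (before _ _ kN); rewrite kt ltW.
      rewrite taulast ?tN ?(le_trans th) ?lerD2l ?(ltW hW)// /strip /=.
      by apply: hin; lra.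
    - move=> t /andP[ht tW]; rewrite taulast /strip /=; last by lra.
      by apply: hout; lra.
  rewrite epE E; split=> //; rewrite /exit_point E /= taulast; last by lra.
  by congr (_, _ + c * _ * _); lra.
have cne : c != 0 by rewrite gt_eqF.
have dir : diry (heading N) != 0 :> R -> dirx (heading N) = 0 :> R.
  by case: (Z4_cases (heading N)) => ->; rewrite /dirx /diry /= ?eqxx.
move=> out; have hn : diry (heading N) != 0 :> R.
  by apply: contraNneq out => ->; rewrite mulr0 addr0; lra.
have dx0 := dir hn; rewrite dx0 mulr0 addr0.
have [h1|h1] : diry (heading N) = 1 :> R \/ diry (heading N) = -1 :> R.
  by move: hn; rewrite /diry; case: ifP => _; [left|case: ifP => _; [right|rewrite eqxx]].
- rewrite h1 mulr1 in out *.
  have LW : L < Y + c * W by rewrite ltNge; apply: contra out => ?; lra.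
  have chL : c * ((L - Y) / c) = L - Y by field.
  have hb u : (u <= (L - Y) / c) = (c * u <= L - Y) by rewrite -{2}chL ler_pM2l.
  have hb' u : ((L - Y) / c < u) = (L - Y < c * u) by rewrite -{2}chL ltr_pM2l.
  have [|||fin ->] := finish ((L - Y) / c) _ dx0.
  + by rewrite divr_gt0 ?hb' ?subr_gt0//=; [lra|case/andP: YN].
  + move=> u /andP[u0]; rewrite hb h1 mulr1 => uL.
    have : 0 <= c * u by rewrite mulr_ge0// ltW.
    by lra.
  + by move=> u /andP[]; rewrite hb' h1 mulr1; lra.
  + split => //; split => //=; rewrite h1 mulr1 chL; split; lra.
- rewrite h1 mulrN1 in out *.
  have LW : Y - c * W < 0 by rewrite ltNge; apply: contra out => ?; lra.
  have chL : c * (Y / c) = Y by field.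
  have hb u : (u <= Y / c) = (c * u <= Y) by rewrite -{2}chL ler_pM2l.
  have hb' u : (Y / c < u) = (Y < c * u) by rewrite -{2}chL ltr_pM2l.
  have [|||fin ->] := finish (Y / c) _ dx0.
  + by rewrite divr_gt0 ?hb'//=; [lra|case/andP: YN].
  + move=> u /andP[u0]; rewrite hb h1 mulrN1 => uL.
    have : 0 <= c * u by rewrite mulr_ge0// ltW.
    by lra.
  + by move=> u /andP[]; rewrite hb' h1 mulrN1; lra.
  + split => //; split => //=; rewrite h1 mulrN1 chL; split; lra.
Qed.

Lemma chain_frozen n m : ~~ alive L (Z n w) -> (n <= m)%N -> Z m w = Z n w.
Proof.
move=> nal /subnK <-; elim: (m - n)%N => [|k IH]; first by rewrite add0n.
by rewrite addSn /= IH /step (negbTE nal).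
Qed.

Lemma value_exit alpha beta g1 g3 : exists N, forall n, (N <= n)%N ->
  value lambda c L alpha beta x g1 g3 (Z n w) =
  cos (phase alpha beta x (exit_point M c L x y w).1) * \1_(lower_exit M c L x y) w.
Proof.
have [N [nal [fin [E1 E2]]]] := exit_chain; exists N => n Nn.
rewrite (chain_frozen nal Nn) /value E1 indicE.
case: ifPn => neg.
  by rewrite mem_set ?mulr1//; split => //; apply/E2.
rewrite memNset; last by move=> [_ /E2]; exact/negP.
rewrite mulr0 ifT//.
by move: nal neg; rewrite /alive negb_and -!ltNge => /orP[->|->].
Qed.

End Path.

(** * The conditional expectation given the initial direction *)
Section InitialDirection.
Context d {T : measurableType d} {R : realType} {P : probability T R} {lambda : R}.
Variable M : motion_noise P lambda.

Lemma measurable_heading n : measurable_fun setT (fun w => heading M w n).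
Proof.
elim: n => [|n IH].
  rewrite (_ : (fun _ => _) = init M); first exact: measurable_funPT.
  by apply/funext => w; rewrite /heading big_ord0 addr0.
rewrite (_ : (fun _ => _) = fun w => if turn M n w
  then turned true (heading M w n) else turned false (heading M w n)); last first.
  by apply/funext => w; rewrite headingS; case: (turn M n w).
apply: measurable_fun_ifT; first exact: measurable_funPT.
- exact: (measurableT_comp (@measurable_Z4 _ _ (turned true)) IH).
- exact: (measurableT_comp (@measurable_Z4 _ _ (turned false)) IH).
Qed.

Lemma measurable_arrival n : measurable_fun setT (arrival M n).
Proof.
by apply: measurable_sum => i; exact: measurable_wait.
Qed.

(** Events at time 0 have probability zero but are not excluded. The set of
    the events up to time 0 takes countably many finite values, each on a
    measurable set; the remaining points are those where it is infinite and
    where its cardinal is 0 by convention. *)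
Lemma measurable_direction_at0 j : measurable [set w | direction_at M 0 w = j].
Proof.
pose S w : set nat := [set k | arrival M k.+1 w <= 0].
pose E (F : {fset nat}) := [set w | S w = [set` F]].
have mE F : measurable (E F).
  have -> : E F = \bigcap_k [set w | (arrival M k.+1 w <= 0) = (k \in F)].
    rewrite eqEsubset; split => w /=.
      move=> SF k _ /=; apply/idP/idP => h.
        by have : [set` F] k by rewrite -SF.
      by have : S w k by rewrite SF.
    move=> H; rewrite /E /= eqEsubset; split => k /=; rewrite /S /=.
      by rewrite (H k I).
    by move=> kF; rewrite (H k I).
  apply: bigcap_measurable; first by exists 0%N.
  move=> k _; have mle : measurable_fun setT (fun w => arrival M k.+1 w <= 0).
    by apply: measurable_fun_ler => //; exact: measurable_arrival.
  by rewrite -[X in measurable X]setTI; exact: (mle measurableT [set (k \in F)]).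
have mD n : measurable [set w | heading M w n = j].
  by rewrite -[X in measurable X]setTI; exact: (@measurable_heading n measurableT [set j]).
have mU : measurable (\bigcup_F E F).
  by apply: countable_bigcupT_measurable => //; exact: countableP.
have -> : [set w | direction_at M 0 w = j] =
  (\bigcup_(F : {fset nat}) (E F `&` [set w | heading M w #|` F|%fset = j])) `|`
  (~` (\bigcup_F E F) `&` [set w | heading M w 0 = j]).
  have cnt F w : E F w -> event_count M 0 w = #|` F|%fset.
    by move=> EF; rewrite /event_count -/(S w) EF set_fsetK.
  have cnt0 w : (~` (\bigcup_F E F)) w -> event_count M 0 w = 0%N.
    move=> nE; rewrite /event_count -/(S w) /fset_set.
    case: pselect => [Sfin|_]; last exact: cardfs0.
    by exfalso; apply: nE; exists (fset_set (S w)) => //; rewrite /E /= fset_setK.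
  rewrite eqEsubset; split => w /=.
    rewrite /direction_at => wj; have [[F _ EF]|nE] := pselect ((\bigcup_F E F) w).
      by left; exists F => //; split => //=; rewrite /heading -(cnt _ _ EF).
    by right; split => //=; rewrite -wj (cnt0 _ nE).
  case=> [[F _ [EF <-]]|[nE <-]]; first by rewrite /direction_at (cnt _ _ EF).
  by rewrite /direction_at (cnt0 _ nE).
apply: measurableU; last by apply: measurableI => //; exact: measurableC.
apply: countable_bigcupT_measurable; first exact: countableP.
by move=> F; exact: measurableI.
Qed.

Variable nu : probability (measurableTypeR R) R.
Hypothesis nuE : forall A, measurable A -> nu A = exponential_prob lambda A.

Lemma direction_at0 w : (forall k, 0 < wait M k w) -> direction_at M 0 w = init M w.
Proof.
move=> w0; rewrite (@direction_atE _ _ _ _ _ _ _ w0 0).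
  by rewrite /heading big_ord0 addr0.
by rewrite arrivalS arrival0 lexx add0r w0.
Qed.

Lemma direction_at0_prob j : P [set w | direction_at M 0 w = j] = (4^-1)%:E.
Proof.
rewrite -(init_uniform M j); have [N [mN N0 bad]] := ae_wait_gt0 M nuE.
have mA := measurable_direction_at0 j.
have mI : measurable (init M @^-1` [set j]) := noise_sigma_measurable (noise_sigma_init M j).
have off A : measurable A -> P A = P (A `\` N).
  move=> mB; apply: etrans (measureDI P mB mN) _.
  rewrite [X in (_ + X)%E](_ : _ = 0%E) ?adde0//.
  by apply: subset_measure0 N0; [exact: measurableI|exact: mN|exact: subIsetr].
rewrite off// [RHS]off//; congr (P _); rewrite eqEsubset; split => w [wj wN]; split => //;
  have w0 : forall k, 0 < wait M k w by (apply: contrapT => h; apply: wN; exact: bad).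
  by rewrite /= -(direction_at0 w0).
by rewrite /= (direction_at0 w0).
Qed.

End InitialDirection.

Section Solution.
Context d {T : measurableType d} {R : realType} {P : probability T R} {lambda : R}.
Variables (M : motion_noise P lambda) (c L alpha : R) (g1 g3 : R -> R).
Hypotheses (lambda_gt0 : 0 < lambda) (c_gt0 : 0 < c) (L_gt0 : 0 < L).
Let kap := lambda ^+ 2 / (lambda ^+ 2 + (alpha * c) ^+ 2).
Let mean y := (g1 y + g3 y) / 2.
Hypothesis dg1 : forall y : R, is_derive y 1 g1 (lambda * (g1 y - kap * mean y) / c).
Hypothesis dg3 : forall y : R, is_derive y 1 g3 (lambda * (kap * mean y - g3 y) / c).
Hypotheses (g1_L : g1 L = 0) (g3_0 : g3 0 = 1).

Lemma u_tilde_value (x y z : R) j : 0 < y < L ->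
  u_tilde M c L x j alpha y z =
  cis (alpha * z) * (value_at lambda c alpha g1 g3 j 0 y
                     +i* value_at lambda c alpha g1 g3 j (pi / 2) y)%C.
Proof.
move=> yin; pose nu : probability (measurableTypeR R) R :=
  exponential_distribution_exponential_prob__canonical__probability_measure_Probability lambda_gt0.
have nuE A : measurable A -> nu A = exponential_prob lambda A by [].
have L_c : 0 < L / c by rewrite divr_gt0.
pose A : set T := [set w | direction_at M 0 w = j].
have good : {ae P, forall w, forall beta, exists N, forall n, (N <= n)%N ->
    cos (phase alpha beta x (exit_point M c L x y w).1) * \1_(lower_exit M c L x y) w * \1_A w =
    value lambda c L alpha beta x g1 g3 (chain M c L (j, (x, y)) n w) *
    \1_(init M @^-1` [set j]) w}.
  have := ae_chain_off_boundary M c_gt0 nuE (s0 := (j, (x, y))) yin.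
  have := ae_long_wait M lambda_gt0 nuE L_c.
  have := ae_wait_gt0 M nuE.
  apply: filterS3 => w w0 wl off beta.
  have Aj : \1_A w = \1_(init M @^-1` [set j]) w :> R.
    rewrite !indicE (_ : (w \in A) = (w \in init M @^-1` [set j]))//.
    by apply/idP/idP; rewrite !inE /A /= direction_at0.
  rewrite Aj; have [wj|wj] := eqVneq (init M w) j; last first.
    exists 0%N => n _; rewrite [\1__ w]indicE memNset ?mulr0//.
    by move=> /= /eqP; exact/negP.
  have [|N HN] := @value_exit _ _ _ _ _ M c L x y w c_gt0 w0 wl yin _ alpha beta g1 g3.
    by rewrite wj.
  by exists N => n Nn; have := HN n Nn; rewrite wj => ->.
have value0 beta : value lambda c L alpha beta x g1 g3 (j, (x, y)) = value_at lambda c alpha g1 g3 j beta y.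
  case/andP: yin => y0 yL; rewrite /value /= !ltNge (ltW y0) (ltW yL) /=.
  by rewrite /phase subrr mulr0 add0r.
have expect beta f : (forall w, f w = cos (phase alpha beta x (exit_point M c L x y w).1) *
    \1_(lower_exit M c L x y) w * \1_A w) ->
    fine ('E_P[f]) / fine (P A) = value_at lambda c alpha g1 g3 j beta y.
  move=> fE; rewrite (expectation_eventually_value (M := M) lambda_gt0 c_gt0 L_gt0 nuE
     dg1 dg3 g1_L g3_0 (s0 := (j, (x, y))) (j := j) (beta := beta) (x0 := x)).
    by rewrite (direction_at0_prob M nuE) value0 /=; field.
  by apply: filterS good => w /(_ beta)[N HN]; exists N => n /HN <-.
rewrite /u_tilde; congr (_ * _); rewrite /cond_expectation; congr (_ +i* _)%C.
- apply: expect => w; rewrite /phase /cis /=.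
  by rewrite addr0 cosN mulr0 subr0.
- apply: expect => w; rewrite /phase /cis /=.
  by rewrite cosDpihalf sinN mulr0 add0r.
Qed.

End Solution.

(** * The explicit solution *)
Section ExplicitSolution.
Context {R : realType}.
Variables (lambda c L alpha : R).
Hypotheses (lambda_gt0 : 0 < lambda) (c_gt0 : 0 < c) (L_gt0 : 0 < L) (alpha_neq0 : alpha != 0).

(** The modulus of the complex number lambda + i alpha c. *)
Definition modulus : R := Num.sqrt (lambda ^+ 2 + alpha ^+ 2 * c ^+ 2).
Definition rate (h : R) : R := `|alpha| * lambda * h / modulus.
Definition up_coef : R := (modulus + `|alpha| * c) ^+ 2.
Definition down_coef : R := (modulus - `|alpha| * c) ^+ 2.
Definition denom : R := up_coef * expR (rate L) - down_coef * expR (- rate L).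

Definition upward y : R := 2 * lambda ^+ 2 * sinh (rate (L - y)) / denom.
Definition downward y : R :=
  (up_coef * expR (rate (L - y)) - down_coef * expR (- rate (L - y))) / denom.

Let s := modulus.
Let a : R := `|alpha|.
Let kap := lambda ^+ 2 / (lambda ^+ 2 + (alpha * c) ^+ 2).
Let mean y := (upward y + downward y) / 2.

Let a_gt0 : 0 < a. Proof. by rewrite normr_gt0. Qed.

Let s2 : s ^+ 2 = lambda ^+ 2 + a ^+ 2 * c ^+ 2.
Proof.
rewrite /a real_normK ?num_real// /s /modulus sqr_sqrtr//.
by rewrite addr_ge0 ?sqr_ge0// -exprMn sqr_ge0.
Qed.

Let s_gt0 : 0 < s.
Proof.
rewrite /s /modulus sqrtr_gt0 ltr_pwDl ?exprn_gt0//.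
by rewrite -exprMn sqr_ge0.
Qed.

Lemma denom_gt0 : 0 < denom.
Proof.
have rL : 0 < rate L by rewrite divr_gt0 ?mulr_gt0.
have e1 : 1 < expR (rate L) by rewrite -[ltLHS]expR0 ltr_expR.
have e2 : expR (- rate L) < 1 by rewrite -[ltRHS]expR0 ltr_expR oppr_lt0.
have ac : 0 < a * c by rewrite mulr_gt0.
have du : down_coef < up_coef.
  by rewrite -subr_gt0 /up_coef /down_coef -/s -/a; have := mulr_gt0 s_gt0 ac; nra.
have d0 : 0 <= down_coef := sqr_ge0 _.
by rewrite /denom subr_gt0; nra.
Qed.

Let e1 y := expR (rate (L - y)).
Let e2 y := expR (- rate (L - y)).

Let de1 (y : R) : is_derive y 1 e1 (- (a * lambda / s) * e1 y).
Proof.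
have E z : rate (L - z) = rate L + - (a * lambda / s) * z by rewrite /rate -/s -/a; ring.
rewrite /e1 E (_ : (fun z => _) = fun z => expR (rate L + - (a * lambda / s) * z)).
  exact: is_derive_comp_affine.
by apply/funext => z; rewrite E.
Qed.

Let de2 (y : R) : is_derive y 1 e2 (a * lambda / s * e2 y).
Proof.
have E z : - rate (L - z) = - rate L + a * lambda / s * z by rewrite /rate -/s -/a; ring.
rewrite /e2 E (_ : (fun z => _) = fun z => expR (- rate L + a * lambda / s * z)).
  exact: is_derive_comp_affine.
by apply/funext => z; rewrite E.
Qed.

Let s_neq0 : s != 0. Proof. by rewrite gt_eqF. Qed.
Let c_neq0 : c != 0. Proof. by rewrite gt_eqF. Qed.
Let denom_neq0 : denom != 0. Proof. by rewrite gt_eqF ?denom_gt0. Qed.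

Let upwardE y : upward y = lambda ^+ 2 / denom * e1 y + - (lambda ^+ 2 / denom) * e2 y.
Proof. by rewrite /upward /sinh -/(e1 y) -/(e2 y); field. Qed.

Let downwardE y : downward y =
  (s + a * c) ^+ 2 / denom * e1 y + - ((s - a * c) ^+ 2 / denom) * e2 y.
Proof. by rewrite /downward /up_coef /down_coef -/s -/a -/(e1 y) -/(e2 y); field. Qed.

Let lambda2 : lambda ^+ 2 = s ^+ 2 - a ^+ 2 * c ^+ 2.
Proof. by rewrite s2 addrK. Qed.

Let kapE : kap = lambda ^+ 2 / s ^+ 2.
Proof. by rewrite /kap exprMn s2 /a real_normK ?num_real. Qed.

(** Both coefficients come from
    lambda^2 + (s +- a c)^2 = 2 s (s +- a c). *)
Let kap_mean y : kap * mean y =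
  lambda ^+ 2 / (s * denom) * ((s + a * c) * e1 y - (s - a * c) * e2 y).
Proof.
rewrite kapE /mean upwardE downwardE.
have -> : (lambda ^+ 2 / denom * e1 y + - (lambda ^+ 2 / denom) * e2 y +
   ((s + a * c) ^+ 2 / denom * e1 y + - ((s - a * c) ^+ 2 / denom) * e2 y)) / 2 =
   s / denom * ((s + a * c) * e1 y - (s - a * c) * e2 y).
  by rewrite lambda2; field.
by field; rewrite s_neq0 denom_neq0.
Qed.

Lemma is_derive_upward (y : R) :
  is_derive y 1 upward (lambda * (upward y - kap * mean y) / c).
Proof.
have -> : upward = fun y => lambda ^+ 2 / denom * e1 y + - (lambda ^+ 2 / denom) * e2 y.
  by apply/funext => z; rewrite upwardE.
have := is_derive_add (is_derive_mull (lambda ^+ 2 / denom) (de1 y))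
  (is_derive_mull (- (lambda ^+ 2 / denom)) (de2 y)).
move=> h; apply: is_derive_eq; rewrite kap_mean.
by field; rewrite c_neq0 denom_neq0 s_neq0.
Qed.

Lemma is_derive_downward (y : R) :
  is_derive y 1 downward (lambda * (kap * mean y - downward y) / c).
Proof.
have -> : lambda * (kap * mean y - downward y) / c =
    - (a * lambda / s) * ((s + a * c) ^+ 2 / denom * e1 y + (s - a * c) ^+ 2 / denom * e2 y).
  by rewrite kap_mean downwardE lambda2; field; rewrite c_neq0 denom_neq0 s_neq0.
have -> : downward =
    fun y => (s + a * c) ^+ 2 / denom * e1 y + - ((s - a * c) ^+ 2 / denom) * e2 y.
  by apply/funext => z; rewrite downwardE.
have := is_derive_add (is_derive_mull ((s + a * c) ^+ 2 / denom) (de1 y))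
  (is_derive_mull (- ((s - a * c) ^+ 2 / denom)) (de2 y)).
move=> h; apply: is_derive_eq.
by field; rewrite denom_neq0 s_neq0.
Qed.

Lemma upward_top : upward L = 0.
Proof.
by rewrite /upward /rate subrr mulr0 mul0r /sinh oppr0 subrr !(mul0r, mulr0).
Qed.

Lemma downward_bottom : downward 0 = 1.
Proof. by rewrite /downward subr0 divff. Qed.

End ExplicitSolution.

Local Open Scope complex_scope.

Theorem theorem5 (d : measure_display) (T : measurableType d) (R : realType)
  (P : probability T R) (lambda c L : R)
  (hlambda : 0 < lambda) (hc : 0 < c) (hL : 0 < L)
  (M : motion_noise P lambda)
  (x y z alpha : R) (hy : 0 < y < L) (halpha : alpha != 0) :
  let s : R := Num.sqrt (lambda ^+ 2 + alpha ^+ 2 * c ^+ 2) in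
  let rate (h : R) : R := `|alpha| * lambda * h / s in
  let den : R := (s + `|alpha| * c) ^+ 2 * expR (rate L)
               - (s - `|alpha| * c) ^+ 2 * expR (- rate L) in
  let u (j : 'Z_4) : R[i] := u_tilde M c L x j alpha y z in
  [/\ u 1 = (2 * lambda ^+ 2 * sinh (rate (L - y)))%:C * cis (alpha * z) / den%:C,
      u 3 = cis (alpha * z) *
            (((s + `|alpha| * c) ^+ 2 * expR (rate (L - y))
            - (s - `|alpha| * c) ^+ 2 * expR (- rate (L - y))) / den)%:C,
      u 0 = lambda%:C / (2 * (lambda +i* (c * alpha))) * (u 1 + u 3)
    & u 2 = lambda%:C / (2 * (lambda -i* (c * alpha))) * (u 1 + u 3)].
Proof.
move=> s rate0 den u.
pose g1 := upward lambda c L alpha; pose g3 := downward lambda c L alpha.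
have uE j : u j = cis (alpha * z) * (value_at lambda c alpha g1 g3 j 0 y
                     +i* value_at lambda c alpha g1 g3 j (pi / 2) y)%C.
  exact: (u_tilde_value M hlambda hc hL (is_derive_upward hlambda hc hL halpha)
    (is_derive_downward hlambda hc hL halpha) (upward_top _ _ _ _)
    (downward_bottom hlambda hc hL halpha) x z j hy).
have u1 : u 1 = cis (alpha * z) * (g1 y)%:C.
  by rewrite uE /value_at /= cos0 cos_pihalf mul1r mul0r.
have u3 : u 3 = cis (alpha * z) * (g3 y)%:C.
  by rewrite uE /value_at /= cos0 cos_pihalf mul1r mul0r.
(* e = 1 for the direction to the right, e = -1 for the direction to the left. *)
have sideways (e : R) : e ^+ 2 = 1 ->
    ((lambda ^+ 2 * cos 0 - lambda * (alpha * c * e) * sin 0) / (lambda ^+ 2 + (alpha * c) ^+ 2) *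
       ((g1 y + g3 y) / 2)
     +i* ((lambda ^+ 2 * cos (pi / 2) - lambda * (alpha * c * e) * sin (pi / 2)) /
       (lambda ^+ 2 + (alpha * c) ^+ 2) * ((g1 y + g3 y) / 2)))%C
    = lambda%:C / (2 * (lambda +i* (e * (c * alpha)))%C) * ((g1 y)%:C + (g3 y)%:C).
  move=> e2; rewrite cos0 sin0 cos_pihalf sin_pihalf.
  have w0 : (lambda +i* (e * (c * alpha)))%C != 0.
    by rewrite eq_complex /= negb_and gt_eqF.
  have w2 : 2 * (lambda +i* (e * (c * alpha)))%C != 0.
    by rewrite mulf_neq0 // pnatr_eq0.
  (* Multiplying out leaves a polynomial identity in each of the two parts. *)
  apply: (mulIf w2); rewrite [RHS]mulrAC divfK//.
  have -> : (alpha * c) ^+ 2 = (alpha * c * e) ^+ 2 by rewrite [RHS]exprMn e2 mulr1.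
  have q0' : lambda ^+ 2 + (alpha * c * e) ^+ 2 != 0.
    by rewrite gt_eqF// ltr_pwDl ?exprn_gt0// sqr_ge0.
  have -> : 2 = 2%:C :> R[i] by rewrite (rmorph_nat (real_complex R)).
  apply/eqP; rewrite eq_complex /=; apply/andP; split; apply/eqP;
    by field; exact: q0'.
split.
- rewrite u1 mulrAC [in LHS]mulrC; congr (_ * _).
  by rewrite /g1 /upward -(fmorphV (real_complex R)) -(rmorphM (real_complex R)).
- exact: u3.
- rewrite u1 u3 -mulrDr mulrCA uE; congr (_ * _).
  have := sideways 1; rewrite mul1r => <-; last by rewrite expr1n.
  by [].
- rewrite u1 u3 -mulrDr mulrCA uE; congr (_ * _).
  have := sideways (-1); rewrite mulN1r => <-; last by rewrite sqrrN expr1n.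
  by [].
Qed.
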